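(* Let $\Gamma$ be a finitely generated marked group, let $(X,\mu)$ be a standard probability space, and let $\mathsf a,\mathsf b:\Gamma\curvearrowright (X,\mu)$ be free probability-measure-preserving (pmp) actions. The following are equivalent: (1) $\mathsf a$ weakly contains $\mathsf b$; (2) for all $r,k\in\mathbb N$, $\mathcal L_{r,k}(\mathsf b)\subseteq \mathcal L_{r,k}(\mathsf a)$ (i.e. the local statistics of every measurable labelling for $\mathsf b$ are approximated arbitrarily well by local statistics of measurable labellings for $\mathsf a$); (3) for every $\Sigma_1$-sentence $\phi$, $\phi^{\mathsf a}\le \phi^{\mathsf b}$.
   Context: A marked group is a group $\Gamma$ with a specified finite symmetric generating set $E$; $e$ is the identity and $B_r(e)$ is the ball of radius $r$ around $e$ in the Cayley graph (word metric). $[k]=\{1,\dots,k\}$. Weak containment. For a nonprincipal ultrafilter $\mathcal U$ on $\mathbb N$, the ultrapower $\mathsf a^{\mathcal U}$ of a pmp action $\mathsf a:\Gamma\curvearrowright(X,\mu)$ is the coordinatewise action of $\Gamma$ on $X_{\mathcal U}=X^{\mathbb N}/\!\sim_{\mathcal U}$ (sequences identified when they agree on a set in $\mathcal U$), equipped with the (complete, generally nonstandard) probability measure $\mu_{\mathcal U}$ determined by $\mu_{\mathcal U}(\{[x_i]: \{i:x_i\in A_i\}\in\mathcal U\})=\lim_{\mathcal U}\mu(A_i)$ for measurable $A_i\subseteq X$. An action contains $\mathsf b$ if it factors onto $\mathsf b$ by a measure-preserving ($\Gamma$-equivariant a.e.) map; $\mathsf a$ weakly contains $\mathsf b$ if some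 ultrapower $\mathsf a^{\mathcal U}$ contains $\mathsf b$. Local statistics for free actions. For measurable $f:X\to[k]$ and $r\in\mathbb N$, $\mu^r(f)$ is the probability measure on the finite set $[k]^{B_r(e)}$ given by $\mu^r(f)(\{g\})=\mu(\{x:(\forall\gamma\in B_r(e))\ f(\gamma\cdot x)=g(\gamma)\})$. $\mathcal L_{r,k}(\mathsf a)$ is the closure, in total variation distance, of $\{\mu^r(f): f:X\to[k]\text{ measurable}\}$. Model theory. $M(\mathsf a)$ is $L^2(X,\mu)$ with its Hilbert space operations, pointwise multiplication and pointwise conjugation $*$, the constant function $\mathbf 1$, and the automorphisms $(\gamma\cdot f)(x)=f(\gamma^{-1}\cdot x)$; since products must be defined, variables range over bounded functions, i.e. over $L^\infty(X,\mu)$. Terms are built from variables and $\mathbf 1$ by sums, pointwise products, $*$, multiplication by scalars in $\mathbb C$, and $\tau\mapsto\gamma\cdot\tau$ for $\gamma\in\Gamma$. Quantifier-free formulas are built from the real and imaginary parts of $\langle\tau_1,\tau_2\rangle=\int\tau_1\overline{\tau_2}\,d\mu$ ($\tau_1,\tau_2$ terms) by applying uniformly continuous functions $c:\mathbb R^n\to\mathbb R$. A $\Sigma_1$-sentence is an expression $\phi=\inf_{x_1,\dots,x_n}\psi(x_1,\dots,x_n)$ with $\psi$ a quantifier-free formula that is bounded below; $\phi^{\mathsf a}\in\mathbb R$ is its value when the infimum is taken over $M(\mathsf a)$. *)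

(* Defs.v *)
From HB Require Import structures.
From mathcomp Require Import all_boot all_order all_algebra finmap generic_quotient.
From mathcomp Require Import all_classical all_reals all_analysis.
From mathcomp Require Import complex.
Set Implicit Arguments.
Unset Strict Implicit.
Unset Printing Implicit Defensive.
Import Order.TTheory GRing.Theory Num.Theory.
Import numFieldNormedType.Exports.
Local Open Scope classical_set_scope.
Local Open Scope ring_scope.
Local Open Scope quotient_scope.

Record np_ultrafilter := NPUltrafilter {
  large : set_system nat;
  large_ultra : UltraFilter large;
  large_nonprincipal : forall n, ~ large [set n] }.
#[global] Existing Instance large_ultra.

Section ultrapower_space.
Variables (U : np_ultrafilter) (X : pointedType).

Definition ultra_eq : rel (nat -> X) :=
  fun x y => `[< large U [set i | x i = y i] >].

Lemma ultra_eq_refl : reflexive ultra_eq.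
Proof. by move=> x; apply/asboolP; apply: filterS filterT => i _. Qed.

Lemma ultra_eq_sym : symmetric ultra_eq.
Proof.
by move=> x y; apply: asbool_equiv_eq; split; apply: filterS => i /= ->.
Qed.

Lemma ultra_eq_trans : transitive ultra_eq.
Proof.
move=> y x z /asboolP xy /asboolP yz; apply/asboolP.
by apply: filterS2 xy yz => i /= -> ->.
Qed.

Canonical ultra_eq_equiv :=
  EquivRel ultra_eq ultra_eq_refl ultra_eq_sym ultra_eq_trans.

Definition ultrapower := {eq_quot ultra_eq}.

HB.instance Definition _ := Choice.on ultrapower.
HB.instance Definition _ := EqQuotient.on ultrapower.
HB.instance Definition _ := isPointed.Build ultrapower (\pi_ultrapower point).

Lemma ultrapowerP (x y : nat -> X) :
  \pi_ultrapower x = \pi_ultrapower y <-> large U [set i | x i = y i].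
Proof.
split => [/eqP|xy]; last by apply/eqP; rewrite eqmodE; apply/asboolP.
by rewrite eqmodE => /asboolP.
Qed.

(* the set of classes of the x such that x i is in A i for U-many i *)
Definition internal (A : nat -> set X) : set ultrapower :=
  [set \pi_ultrapower x | x in [set x | large U [set i | A i (x i)]]].

Lemma internalP A x :
  internal A (\pi_ultrapower x) <-> large U [set i | A i (x i)].
Proof.
split => [[y /= yA /ultrapowerP yx]|xA]; last by exists x.
by apply: filterS2 yA yx => i /= ? <-.
Qed.

Lemma internalC A : ~` internal A = internal (fun i => ~` A i).
Proof.
apply/seteqP; split; elim/quotW => x.
  move=> nAx; apply/internalP.
  have [xA|//] := in_ultra_setVsetC [set i | A i (x i)] (large_ultra U).
  by exfalso; apply: nAx; apply/internalP.
move=> /internalP nAx /internalP Ax.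
by apply: (@filter_not_empty _ (large U)); apply: filterS2 Ax nAx => i /=.
Qed.

Lemma internalI A B : internal A `&` internal B = internal (fun i => A i `&` B i).
Proof.
apply/seteqP; split; elim/quotW => x.
  by move=> [/internalP xA /internalP xB]; apply/internalP; exact: filterI.
move=> /internalP xAB; split; apply/internalP;
  by apply: filterS xAB => i [].
Qed.

Lemma internal0 : internal (fun=> set0) = set0.
Proof.
apply/seteqP; split => //; elim/quotW => x /internalP x0.
by apply: (@filter_not_empty _ (large U)); exact: x0.
Qed.

Lemma internalU A B : internal A `|` internal B = internal (fun i => A i `|` B i).
Proof.
by rewrite -[LHS]setCK setCU !internalC internalI internalC; congr internal;
  apply/funext => i; rewrite setCI !setCK.
Qed.

Lemma sub_internal A B :
  internal A `<=` internal B <-> large U [set i | A i `<=` B i].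
Proof.
split=> [AB|AB]; last first.
  elim/quotW => x /internalP xA; apply/internalP.
  by apply: filterS2 AB xA => i /= + xA; apply.
have [//|nAB] := in_ultra_setVsetC [set i | A i `<=` B i] (large_ultra U).
have /choice[x xP] i : exists y, ~ (A i `<=` B i) -> A i y /\ ~ B i y.
  have [?|/existsNP[y /not_implyP yP]] := pselect (A i `<=` B i).
    by exists point.
  by exists y.
have /AB/internalP xB : internal A (\pi_ultrapower x).
  by apply/internalP; apply: filterS nAB => i /= /xP[].
exfalso; apply: (@filter_not_empty _ (large U)).
by apply: filterS2 nAB xB => i /= /xP[].
Qed.

(* countable saturation *)
Lemma internal_compact A (B : nat -> nat -> set X) :
  internal A `<=` \bigcup_j internal (B j) ->
  exists n, internal A `<=` \bigcup_(j < n) internal (B j).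
Proof.
move=> AB; apply: contrapT => /forallNP nAB.
pose C n i := A i `\` \bigcup_(j < n) B j i.
have CU n : large U [set i | C n i !=set0].
  have [//|C0] := in_ultra_setVsetC [set i | C n i !=set0] (large_ultra U).
  exfalso; apply: (nAB n); elim/quotW => x /internalP xA.
  apply: contrapT => xB.
  suff xB' : large U [set i | ~ (\bigcup_(j < n) B j i) (x i)].
    apply: (@filter_not_empty _ (large U)).
    apply: filterS3 C0 xA xB' => i /= Ci xA xB'.
    by apply: Ci; exists (x i).
  have {}xB j : (j < n)%N -> large U [set i | ~ B j i (x i)].
    move=> jn; have [xBj|//] :=
      in_ultra_setVsetC [set i | B j i (x i)] (large_ultra U).
    by exfalso; apply: xB; exists j => //; exact/internalP.
  elim: (n) xB => [|m IH] xB; first by apply: filterS filterT => i _ [].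
  apply: filterS2 (IH (fun j jm => xB j (ltnW jm))) (xB m (ltnSn m)) => i /=.
  move=> h1 h2 [j /=]; rewrite ltnS leq_eqVlt => /orP[/eqP->//|jm xBj].
  by apply: h1; exists j.
have Cle i m n : (m <= n)%N -> C n i `<=` C m i.
  move=> mn y [? yB]; split=> // -[j jm yBj]; apply: yB; exists j => //.
  exact: leq_trans mn.
have cofin n : large U [set i | (n <= i)%N].
  elim: n => [|n IH]; first by apply: filterS filterT.
  have [/large_nonprincipal//|nn] := in_ultra_setVsetC [set n] (large_ultra U).
  apply: filterS2 IH nn => i /= ni /eqP; rewrite eq_sym => ?.
  by rewrite ltn_neqAle ni andbT.
(* x i lies in C n i for all n <= i such that C n i is not empty *)
have /choice[x xP] i : exists y, forall n, (n <= i)%N -> C n i !=set0 -> C n i y.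
  have : forall m, exists y, forall n, (n <= m)%N -> C n i !=set0 -> C n i y.
    elim=> [|m [y yP]].
      have [[y Cy]|C0] := pselect (C 0%N i !=set0).
        by exists y => n; rewrite leqn0 => /eqP->.
      by exists point => n; rewrite leqn0 => /eqP->.
    have [[z Cz]|C0] := pselect (C m.+1 i !=set0).
      by exists z => n nm _; exact: Cle Cz.
    exists y => n; rewrite leq_eqVlt => /orP[/eqP->//|]; exact: yP.
  by move=> /(_ i).
have xC n : large U [set i | C n i (x i)].
  by apply: filterS2 (cofin n) (CU n) => i /= ni; exact: xP.
have [|j _ /internalP xB] := AB (\pi_ultrapower x).
  by apply/internalP; apply: filterS (xC 0%N) => i [].
apply: (@filter_not_empty _ (large U)); apply: filterS2 xB (xC j.+1) => i /= Bi.
by move=> [_]; apply; exists j => /=.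
Qed.

End ultrapower_space.
Arguments internal U {X}.

Definition internal_display : measure_display -> measure_display.
Proof. exact. Qed.

Section ultrapower_measure.
Context (U : np_ultrafilter) (d : measure_display) (X : measurableType d)
        (R : realType) (mu : probability X R).

Definition internal_measurable : set (set (ultrapower U X)) :=
  [set internal U A | A in [set A | forall i, measurable (A i)]].

Let internal_measurable0 : internal_measurable set0.
Proof. by exists (fun=> set0); [|exact: internal0]. Qed.

Let internal_measurableU : setU_closed internal_measurable.
Proof.
move=> _ _ [A mA <-] [B mB <-]; exists (fun i => A i `|` B i).
  by move=> i; exact: measurableU.
by rewrite internalU.
Qed.

Let internal_measurableC : setC_closed internal_measurable.
Proof.
move=> _ [A mA <-]; exists (fun i => ~` A i); last by rewrite internalC.
by move=> i; exact: measurableC.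
Qed.

HB.instance Definition _ := @isAlgebraOfSets.Build (internal_display d)
  (ultrapower U X) internal_measurable internal_measurable0
  internal_measurableU internal_measurableC.

(* On internal U A this is the limit of mu (A i) along U, see ultra_contentE;
   in particular it does not depend on the representation of S. *)
Definition ultra_content (S : set (ultrapower U X)) : \bar R :=
  (get [set l : R | exists A, [/\ forall i, measurable (A i),
     S = internal U A & (fun i => fine (mu (A i))) @ large U --> l]])%:E.

Lemma ultralim_ex (u : nat -> R) : (forall i, 0 <= u i <= 1) ->
  exists l : R, u @ large U --> l.
Proof.
move=> u01; have UU := large_ultra U.
have u01U : (u @ large U) [set` `[0, 1]].
  apply: (@filterS _ (large U) _ setT) filterT => i _ /=.
  by rewrite in_itv/=; exact: u01.
have [l [_ lP]] := @segment_compact R 0 1 (u @ large U) (fmap_proper_filter _ _) u01U.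
exists l => V Vl; rewrite /nbhs/=.
have [//|nV] := in_ultra_setVsetC (u @^-1` V) UU.
by have [y []] := lP (~` V) V nV Vl.
Qed.

Let fine_mu01 (A : nat -> set X) i : measurable (A i) -> 0 <= fine (mu (A i)) <= 1.
Proof.
by move=> mA; rewrite fine_ge0//= -lee_fin fineK ?fin_num_measure// probability_le1.
Qed.

Lemma ultra_contentE (A : nat -> set X) (l : R) :
  (forall i, measurable (A i)) -> (fun i => fine (mu (A i))) @ large U --> l ->
  ultra_content (internal U A) = l%:E.
Proof.
move=> mA Al; rewrite /ultra_content; congr (_%:E).
apply: get_unique; first by exists A.
move=> m [B [mB AB Bm]].
suff Bl : (fun i => fine (mu (B i))) @ large U --> l.
  exact: (@cvg_unique _ _ ((fun i => fine (mu (B i))) @ large U)).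
apply: cvg_trans Al; apply: near_eq_cvg.
have AB' : internal U A = internal U B := AB.
have /sub_internal AB1 : internal U A `<=` internal U B by rewrite AB'.
have /sub_internal AB2 : internal U B `<=` internal U A by rewrite AB'.
apply: filterS2 AB1 AB2 => i /= ? ?.
by congr (fine (mu _)); apply/seteqP; split.
Qed.

Lemma ultra_content_cvg (A : nat -> set X) : (forall i, measurable (A i)) ->
  (fun i => fine (mu (A i))) @ large U --> fine (ultra_content (internal U A)).
Proof.
move=> mA; have [|l Al] := @ultralim_ex (fun i => fine (mu (A i))).
  by move=> i; exact: fine_mu01.
by rewrite (ultra_contentE mA Al).
Qed.

Let ultra_content_fin S : ultra_content S = (fine (ultra_content S))%:E.
Proof. by []. Qed.

Let ultra_content0 : ultra_content set0 = 0%E.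
Proof.
rewrite -(internal0 U X); apply: ultra_contentE => //.
under eq_fun do rewrite measure0/=.
exact: cvg_cst.
Qed.

Let ultra_content_ge0 S : (0 <= ultra_content S)%E.
Proof.
rewrite /ultra_content lee_fin.
have [[l lS]|S0] := pselect ([set l : R | exists A, [/\ forall i, measurable (A i),
     S = internal U A & (fun i => fine (mu (A i))) @ large U --> l]] !=set0).
  have [A [mA _ Al]] := getPex (ex_intro _ l lS).
  by apply: cvgr_to_ge Al _; apply: filterS filterT => i _; rewrite fine_ge0.
by rewrite getPN// => x Sx; apply: S0; exists x.
Qed.

Let ultra_contentU S T : internal_measurable S -> internal_measurable T ->
  S `&` T = set0 -> ultra_content (S `|` T) = (ultra_content S + ultra_content T)%E.
Proof.
move=> [A mA <-] [B mB <-] /seteqP[+ _].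
rewrite internalI internalU -(internal0 U X) => /sub_internal AB0.
have mAB i : measurable (A i `|` B i) by exact: measurableU.
rewrite [X in (X + _)%E]ultra_content_fin [X in (_ + X)%E]ultra_content_fin -EFinD.
apply: ultra_contentE => //.
apply: cvg_trans; last exact: cvgD (ultra_content_cvg mA) (ultra_content_cvg mB).
apply: near_eq_cvg; apply: filterS AB0 => i /=; rewrite subset0 => AB0.
by rewrite measureU// fineD// fin_num_measure.
Qed.

Let ultra_content_semi_sigma_additive : semi_sigma_additive ultra_content.
Proof.
move=> F mF tF [A mA AF].
have /choice[B BP] n : exists B, (forall i, measurable (B i)) /\ internal U B = F n.
  by have [B ? ?] := mF n; exists B.
have [|N NP] := @internal_compact U X A B.
  by rewrite AF => x [n _ Fnx]; exists n => //; rewrite (BP n).2.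
have F0 n : (N <= n)%N -> F n = set0.
  move=> Nn; rewrite -subset0 => x Fnx.
  have [|m /= mN] := NP x; first by rewrite AF; exists n.
  rewrite (BP m).2 => Fmx; have mn : m = n by apply: tF => //; exists x.
  by move: mN; rewrite mn ltnNge Nn.
have sumF n : internal_measurable (\big[setU/set0]_(i < n) F i) /\
    (\sum_(i < n) ultra_content (F i) = ultra_content (\big[setU/set0]_(i < n) F i))%E.
  elim: n => [|n [IH1 IH2]]; first by
    rewrite !big_ord0 ultra_content0; split => //; exact: internal_measurable0.
  rewrite !big_ord_recr/=; split; first exact: internal_measurableU IH1 (mF n).
  rewrite (ultra_contentU IH1 (mF n)) ?IH2//.
  apply: (@trivIset_bigsetUI _ predT) => //.
  by apply: sub_trivIset tF.
apply: cvg_near_cst; exists N => // n /= Nn.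
rewrite big_mkord (sumF n).2; congr ultra_content.
rewrite -bigcup_mkord; apply/seteqP; split => [x [i ? ?]|x [i _ Fix]]; first by exists i.
exists i => //=; rewrite ltnNge; apply/negP => ni.
by move: Fix; rewrite F0// (leq_trans Nn).
Qed.

HB.instance Definition _ := isMeasure.Build _ _ _ ultra_content
  ultra_content0 ultra_content_ge0 ultra_content_semi_sigma_additive.

(* the complete measure obtained by Caratheodory extension: its domain is the
   sigma-algebra of sets measurable for the outer measure of ultra_content *)
Definition ultra_measure :=
  @completed_measure_extension _ (ultrapower U X) R ultra_content.

HB.instance Definition _ := Measure.on ultra_measure.

Let ultra_measureE (S : set (ultrapower U X)) :
  internal_measurable S -> ultra_measure S = ultra_content S.
Proof.
by move=> mS; rewrite /ultra_measure /completed_measure_extension measurable_mu_extE.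
Qed.

Lemma ultra_measure_internal (A : nat -> set X) : (forall i, measurable (A i)) ->
  (fun i => fine (mu (A i))) @ large U --> fine (ultra_measure (internal U A)).
Proof. by move=> mA; rewrite ultra_measureE; [exact: ultra_content_cvg|exists A]. Qed.

Let ultra_measure_setT : ultra_measure setT = 1%E.
Proof.
have mT : internal_measurable setT.
  by rewrite -setC0; apply: internal_measurableC; exact: internal_measurable0.
rewrite ultra_measureE// -setC0 -(internal0 U X) internalC.
apply: ultra_contentE; first by move=> i; exact: measurableC.
under eq_fun do rewrite setC0 probability_setT/=.
exact: cvg_cst.
Qed.

Lemma ultra_measure_complete : measure_is_complete ultra_measure.
Proof. exact: measure_is_complete_caratheodory. Qed.

HB.instance Definition _ := Measure_isProbability.Build _ _ _ ultra_measure
  ultra_measure_setT.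

End ultrapower_measure.
Arguments ultra_content U {d X R} mu.
Arguments ultra_measure U {d X R} mu.

Record pmp_action (G : groupType) d (X : measurableType d) (R : realType)
    (mu : probability X R) := PmpAction {
  act :> G -> X -> X;
  act1 : forall x, act 1%g x = x;
  actM : forall g h x, act (g * h)%g x = act g (act h x);
  measurable_act : forall g, measurable_fun [set: X] (act g);
  act_preserving : forall g A, measurable A -> mu (act g @^-1` A) = mu A }.

(* free in the measure-theoretic sense: almost every stabilizer is trivial *)
Definition free_action (G : groupType) d (X : measurableType d) (R : realType)
    (mu : probability X R) (a : pmp_action G mu) :=
  {ae mu, forall x, forall g, a g x = x -> g = 1%g}.

(* a contains b: a factors onto b *)
Definition contains (G : groupType) (R : realType)
    d (X : measurableType d) (mu : probability X R)
    d' (Y : measurableType d') (nu : probability Y R)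
    (a : pmp_action G mu) (b : pmp_action G nu) :=
  exists f : X -> Y, [/\ measurable_fun [set: X] f,
    forall B, measurable B -> mu (f @^-1` B) = nu B &
    forall g, {ae mu, forall x, f (a g x) = b g (f x)}].

Section ultrapower_action.
Context (U : np_ultrafilter) (G : groupType) (R : realType)
        (d : measure_display) (X : measurableType d) (mu : probability X R)
        (a : pmp_action G mu).

Definition ultra_act (g : G) (x : ultrapower U X) : ultrapower U X :=
  \pi_(ultrapower U X) (fun i => a g (repr x i)).

Lemma ultra_act_pi g (x : nat -> X) :
  ultra_act g (\pi_(ultrapower U X) x) =
  \pi_(ultrapower U X) (fun i => a g (x i)).
Proof.
apply/ultrapowerP.
have /ultrapowerP : \pi_(ultrapower U X) (repr (\pi_(ultrapower U X) x)) = \pi_(ultrapower U X) x.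
  by rewrite reprK.
by apply: filterS => i /= ->.
Qed.

Lemma ultra_act1 x : ultra_act 1%g x = x.
Proof.
elim/quotW: x => x; rewrite ultra_act_pi; congr (\pi_(ultrapower U X) _).
by apply/funext => i; rewrite act1.
Qed.

Lemma ultra_actM g h x : ultra_act (g * h)%g x = ultra_act g (ultra_act h x).
Proof.
elim/quotW: x => x; rewrite (ultra_act_pi h) !ultra_act_pi; congr (\pi_(ultrapower U X) _).
by apply/funext => i; rewrite actM.
Qed.

Let ultra_act_internal g (A : nat -> set X) :
  ultra_act g @^-1` internal U A = internal U (fun i => a g @^-1` A i).
Proof.
apply/seteqP; split; elim/quotW => x.
  by rewrite /preimage/= ultra_act_pi => /internalP ?; apply/internalP.
by rewrite /preimage/= ultra_act_pi => /internalP ?; apply/internalP.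
Qed.

Let ultra_content_act g (S : set (ultrapower U X)) : measurable S ->
  measurable (ultra_act g @^-1` S) /\
  ultra_content U mu (ultra_act g @^-1` S) = ultra_content U mu S.
Proof.
move=> [A mA <-].
have mgA i : measurable (a g @^-1` A i).
  by rewrite -[_ @^-1` _]setTI; exact: measurable_act.
rewrite ultra_act_internal; split; first by exists (fun i => a g @^-1` A i).
apply: ultra_contentE => //.
under eq_fun do rewrite act_preserving//.
exact: ultra_content_cvg.
Qed.

Let ultra_measure_act_le g (S : set (ultrapower U X)) :
  (ultra_measure U mu (ultra_act g @^-1` S) <= ultra_measure U mu S)%E.
Proof.
apply: le_ereal_inf_tmp => _ [F [mF SF] <-].
apply: ereal_inf_lbound; exists (fun n => ultra_act g @^-1` F n).
  split; first by move=> n; exact: (ultra_content_act g (mF n)).1.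
  by move=> x /SF[n _ ?]; exists n.
by apply: eq_eseriesr => n _; exact: (ultra_content_act g (mF n)).2.
Qed.

Let ultra_act_preimageV g (S : set (ultrapower U X)) :
  ultra_act g^-1%g @^-1` (ultra_act g @^-1` S) = S.
Proof.
by apply/seteqP; split=> x; rewrite /preimage/= -ultra_actM mulgV ultra_act1.
Qed.

Let ultra_measure_act g (S : set (ultrapower U X)) :
  ultra_measure U mu (ultra_act g @^-1` S) = ultra_measure U mu S.
Proof.
apply/eqP; rewrite eq_le ultra_measure_act_le/=.
by rewrite -{1}(ultra_act_preimageV g S) ultra_measure_act_le.
Qed.

Let measurable_ultra_act g :
  measurable_fun [set: caratheodory_type (ultra_content U mu)^*%mu] (ultra_act g :
    caratheodory_type (ultra_content U mu)^*%mu -> caratheodory_type (ultra_content U mu)^*%mu).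
Proof.
move=> _ S mS; rewrite setTI.
suff : ((ultra_content U mu)^*%mu).-caratheodory (ultra_act g @^-1` S) by [].
move=> T.
have TE : ultra_act g @^-1` (ultra_act g^-1%g @^-1` T) = T.
  by rewrite -{1}(invgK g) ultra_act_preimageV.
have muE := ultra_measure_act g.
rewrite /ultra_measure /completed_measure_extension in muE.
by rewrite -TE preimage_setC -!preimage_setI !muE -mS.
Qed.

Definition ultra_action : pmp_action G (ultra_measure U mu) :=
  @PmpAction G _ _ R (ultra_measure U mu) ultra_act ultra_act1 ultra_actM measurable_ultra_act
   (fun g A _ => ultra_measure_act g A).
End ultrapower_action.

Definition weakly_contains (G : groupType) (R : realType)
    d (X : measurableType d) (mu : probability X R)
    d' (Y : measurableType d') (nu : probability Y R)
    (a : pmp_action G mu) (b : pmp_action G nu) :=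
  exists U : np_ultrafilter, contains (ultra_action U a) b.

(* X is Borel isomorphic to a separable complete metric space *)
Definition standard_borel (R : realType) d (X : measurableType d) :=
  exists (Y : completePseudoMetricType R) (f : X -> Y),
    [/\ hausdorff_space Y,
        exists2 D : set Y, countable D & dense D,
        bijective f &
        @measurable d X = preimage_set_system setT f <<s @open Y >>].

Section marked_group.
Variables (G : groupType) (E : {fset G}).

Definition word_value (w : seq G) : G := foldr (fun x y => x * y)%g 1%g w.

Definition marking :=
  (forall g, g \in E -> g^-1%g \in E) /\
  (forall g, exists2 w, {subset w <= E} & g = word_value w).

Fixpoint cayley_ball (r : nat) : {fset G} :=
  if r is r'.+1 then
    (cayley_ball r' `|` [fset (x * y)%g | x in E, y in cayley_ball r'])%fset
  else [fset 1%g]%fset.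

Lemma in_cayley_ball r g : g \in cayley_ball r <->
  exists w, [/\ (size w <= r)%N, {subset w <= E} & g = word_value w].
Proof.
elim: r g => [|r IH] g /=.
  rewrite inE; split => [/eqP->|[w]]; first by exists [::].
  by rewrite leqn0 => -[/nilP-> _ ->].
rewrite inE; split=> [/orP[/IH[w [wr wE ->]]|/imfset2P[x /= xE [y /=]]]|].
- by exists w; split => //; rewrite leqW.
- move=> /IH[w [wr wE ->]] ->; exists (x :: w); split => // z.
  by rewrite inE => /predU1P[->//|/wE].
- move=> [[|x w] [/= wr wE ->]]; apply/orP.
    by left; apply/IH; exists [::].
  right; apply/imfset2P; exists x; first by apply: wE; rewrite inE eqxx.
  exists (word_value w) => //; apply/IH; exists w; split => // z zw.
  by apply: wE; rewrite inE zw orbT.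
Qed.

End marked_group.

Section finite_distributions.
Variables (R : realType) (T : finType).

Definition distribution_on (p : {ffun T -> R}) :=
  (forall t, 0 <= p t) /\ \sum_t p t = 1.

(* the supremum over events of the difference of their probabilities *)
Definition tv_dist (p q : {ffun T -> R}) : R :=
  \big[Num.max/0]_(A : {set T}) `|\sum_(t in A) p t - \sum_(t in A) q t|.

End finite_distributions.

Section local_statistics.
Context (G : groupType) (E : {fset G}) (R : realType)
        (d : measure_display) (X : measurableType d) (mu : probability X R)
        (a : pmp_action G mu) (r k : nat).

(* the labels 1, ..., k are represented by 'I_k *)
Definition labelling (f : X -> 'I_k) := forall j, measurable (f @^-1` [set j]).

Definition pattern := {ffun cayley_ball E r -> 'I_k}.

Definition local_stat (f : X -> 'I_k) : {ffun pattern -> R} :=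
  [ffun p : pattern =>
    fine (mu [set x | forall g : cayley_ball E r, f (a (val g) x) = p g])].

Lemma local_stat_distribution f : labelling f -> distribution_on (local_stat f).
Proof.
move=> mf.
pose S (p : pattern) := [set x | forall g : cayley_ball E r, f (a (val g) x) = p g].
have mS p : measurable (S p).
  have -> : S p = \bigcap_(g in [set: cayley_ball E r]) (a (val g) @^-1` (f @^-1` [set p g])).
    by apply/seteqP; split => [x Sx g _|x Sx g]; [exact: Sx|exact: (Sx g)].
  apply: fin_bigcap_measurable; first exact: finite_finset.
  by move=> g _; rewrite -[_ @^-1` _]setTI; exact: measurable_act.
split=> [p|]; first by rewrite ffunE fine_ge0.
under eq_bigr do rewrite ffunE.
rewrite sum_fine => [|p _]; last by rewrite fin_num_measure//; exact: mS.
rewrite fsbig_seq ?index_enum_uniq// -measure_fin_bigcup//.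
- transitivity (fine (mu setT)); last by rewrite probability_setT.
  congr (fine (mu _)).
  apply/seteqP; split=> // x _; exists [ffun g => f (a (val g) x)] => [|g].
    exact: mem_index_enum.
  by rewrite ffunE.
- move=> p q _ _ [x [/= xp xq]]; apply/ffunP => g.
  by rewrite -xp -xq.
- by move=> p _; exact: mS.
Qed.

(* closure in total variation, inside the probability measures on patterns *)
Definition local_statistics : set {ffun pattern -> R} :=
  [set p | distribution_on p /\
    forall e : R, 0 < e ->
      exists2 f : X -> 'I_k, labelling f & tv_dist p (local_stat f) < e].

End local_statistics.
Arguments local_stat {G} E {R d X mu} a r {k} f.
Arguments local_statistics {G} E {R d X mu} a r k.

Section model_theory.
Variables (G : groupType) (R : realType) (n : nat).

Inductive term :=
  | Var of 'I_n
  | One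
  | Add of term & term
  | Mul of term & term
  | Star of term
  | Scale of R[i] & term
  | Act of G & term.

Inductive formula :=
  | ReInner of term & term
  | ImInner of term & term
  | Connective m (c : 'rV[R]_m -> R) of unif_continuous c & ('I_m -> formula).

Context d (X : measurableType d) (mu : probability X R) (a : pmp_action G mu).

(* L^oo(X, mu) is represented by functions rather than by classes: equality
   almost everywhere does not affect the values of formulas. *)
Definition Linfty (f : X -> R[i]) :=
  [/\ measurable_fun setT (fun x => complex.Re (f x)),
      measurable_fun setT (fun x => complex.Im (f x)) &
      exists M : R, {ae mu, forall x, ComplexField.Normc.normc (f x) <= M}].

Fixpoint term_val (xs : 'I_n -> X -> R[i]) (t : term) : X -> R[i] :=
  match t with
  | Var i => xs i
  | One => fun=> 1
  | Add s t => fun x => term_val xs s x + term_val xs t x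
  | Mul s t => fun x => term_val xs s x * term_val xs t x
  | Star t => fun x => (term_val xs t x)^*%C
  | Scale z t => fun x => z * term_val xs t x
  | Act g t => fun x => term_val xs t (a g^-1%g x)
  end.

Definition inner (f g : X -> R[i]) : R[i] :=
  let h := fun x => f x * (g x)^*%C in
  ((\int[mu]_x complex.Re (h x)) +i* (\int[mu]_x complex.Im (h x)))%C.

Fixpoint formula_val (xs : 'I_n -> X -> R[i]) (p : formula) : R :=
  match p with
  | ReInner s t => complex.Re (inner (term_val xs s) (term_val xs t))
  | ImInner s t => complex.Im (inner (term_val xs s) (term_val xs t))
  | @Connective m c _ ps => c (\row_j formula_val xs (ps j))
  end.

End model_theory.

(* The bound is uniform over all pmp actions of G on standard probability
   spaces, so that being a sentence does not depend on a structure. *)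
Definition bounded_below (G : groupType) (R : realType) n (p : formula G R n) :=
  exists m : R, forall (d : measure_display) (X : measurableType d)
    (mu : probability X R) (a : pmp_action G mu) (xs : 'I_n -> X -> R[i]),
    standard_borel R X -> (forall i, Linfty mu (xs i)) -> m <= formula_val a xs p.

(* inf over x_0, ..., x_(n-1) of the body, n being the arity *)
Record sigma1_sentence (G : groupType) (R : realType) := Sigma1 {
  sigma1_arity : nat;
  sigma1_body : formula G R sigma1_arity;
  sigma1_bounded : bounded_below sigma1_body }.

Definition sigma1_val (G : groupType) (R : realType)
    d (X : measurableType d) (mu : probability X R) (a : pmp_action G mu)
    (phi : sigma1_sentence G R) : R :=
  inf [set formula_val a xs (sigma1_body phi) |
       xs in [set xs | forall i, Linfty mu (xs i)]].

(* Main.v *)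
Require Import Defs.
From HB Require Import structures.
From mathcomp Require Import all_boot all_order all_algebra finmap generic_quotient.
From mathcomp Require Import all_classical all_reals all_analysis.
From mathcomp Require Import measurable_realfun complex lra ring.
Set Implicit Arguments.
Unset Strict Implicit.
Unset Printing Implicit Defensive.
Import Order.TTheory GRing.Theory Num.Theory.
Import numFieldNormedType.Exports.
Local Open Scope classical_set_scope.
Local Open Scope ring_scope.
Local Open Scope quotient_scope.

(** Local statistics mediate between the two other notions. The ball of radius
    [r] eventually contains every finite subset of the group, so the statistics of
    a labelling [f] determine the measure of every event that depends on finitely
    many coordinates of the itinerary [g |-> f (g x)], and the total variation
    distance bounds the change of this measure from one labelled action to another
    ([cylinder_stat], [cylinder_close]).

    From statistics to sentences ([local_statistics_sigma1]). At a tuple [v \o f]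
    of functions of a labelling with finitely many labels, an inner product of terms
    is the integral of a function of finitely many coordinates of the itinerary, so
    the value of a formula is a continuous function of the statistics
    ([finitely_valued_formula_cvg]). Such tuples are dense for bounded almost
    everywhere convergence ([finitely_valued_approx]), and formulas are continuous
    for it by dominated convergence ([formula_bounded_cvg]).

    From sentences to statistics ([sigma1_local_statistics]). That a labelling has
    statistics close to [q] is expressed with one variable for each pattern, thought
    of as the indicator of the points that see this pattern. The sentence asks that
    square norms of a few terms be close to their values at true indicators. Only
    square norms occur, so a tuple for which it nearly holds is rounded to a
    labelling by Markov's inequality ([pattern_conditions_round]). One-sided
    estimates of the new statistics are enough, both distributions having mass 1
    ([tv_dist_le_onesided]).

    From statistics to weak containment ([local_statistics_weakly_contains]). A
    standard Borel space is coded by sequences of bits, with a measurable left inverse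
    [theta] of the coding ([standard_borel_coding]). Labellings of the first action
    which imitate the first [N] bits of the code at radius [N], for [N] tending to
    infinity, form internal sets of the ultrapower; these sets and their translates
    have the joint law of the code bits and their translates ([internal_copy]).
    Decoding with [theta] is the factor map, whose law and equivariance are properties
    of that joint law.

    From weak containment to statistics ([weakly_contains_local_statistics]). A
    labelling pulled back to the ultrapower is measurable, hence internal up to a
    small error ([internal_approx], [internal_labelling]), and the statistics of an
    internal labelling are limits of statistics of labellings of the first action. *)

(** * Balls and itineraries *)

Section cayley_balls.
Context (G : groupType) (E : {fset G}).

Lemma one_cayley_ball r : 1%g \in cayley_ball E r.
Proof. by apply/in_cayley_ball; exists [::]. Qed.

Lemma cayley_ball_mono r s : (r <= s)%N -> {subset cayley_ball E r <= cayley_ball E s}.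
Proof.
move=> rs g /in_cayley_ball[w [wr wE ->]]; apply/in_cayley_ball.
by exists w; split => //; exact: leq_trans rs.
Qed.

Lemma cayley_ball_cover : marking E -> forall F : seq G,
  exists r, {subset F <= cayley_ball E r}.
Proof.
move=> [_ gen]; elim=> [|g F [r Fr]]; first by exists 0%N.
have [w wE gw] := gen g; exists (maxn (size w) r) => h.
rewrite inE => /predU1P[->|/Fr]; last exact/cayley_ball_mono/leq_maxr.
by apply/in_cayley_ball; exists w; split => //; exact: leq_maxl.
Qed.

End cayley_balls.

Lemma fun_of_finite_measurable d (X : measurableType d) (T : finType) (c : X -> T)
    (S : pred T) : (forall t, measurable [set x | c x = t]) ->
  measurable [set x | S (c x)].
Proof.
move=> mc.
rewrite (_ : mkset _ = \bigcup_(t in [set` [seq t <- enum T | S t]]) [set x | c x = t]).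
  by apply: fin_bigcup_measurable => // t _; exact: mc.
apply/seteqP; split => x /=; first by exists (c x) => //=; rewrite mem_filter mem_enum andbT.
by move=> [t /=]; rewrite mem_filter => /andP[St _] ->.
Qed.

Lemma measurable_finite_code d (X : measurableType d) (T : finType) (C : T -> set X)
    (S : pred {ffun T -> bool}) : (forall t, measurable (C t)) ->
  measurable [set x | S [ffun t => `[< C t x >]]].
Proof.
move=> mC; apply: (fun_of_finite_measurable (c := fun x => [ffun t => `[< C t x >]])) => s.
rewrite (_ : mkset _ = \bigcap_(t in [set: T]) (if s t then C t else ~` C t)).
  apply: fin_bigcap_measurable; first exact: finite_finset.
  by move=> t _; case: (s t) => //; exact: measurableC.
apply/seteqP; split => x /=.
  by move=> <- t _; rewrite ffunE; case: asboolP.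
move=> sx; apply/ffunP => t; rewrite ffunE; have := sx t I.
by case: (s t) => [?|?]; [exact/asboolP|exact/asboolPn].
Qed.

Definition supported_on (G : eqType) (T V : Type) (F : seq G) (h : (G -> T) -> V) :=
  forall w w', {in F, w =1 w'} -> h w = h w'.

Section cylinders.
Context (G : groupType) (E : {fset G}) (R : realType) (k : nat).
Context d (X : measurableType d) (mu : probability X R) (a : pmp_action G mu).
Implicit Types (f : X -> 'I_k) (r : nat).

Definition itinerary T (f : X -> T) (x : X) : G -> T := fun g => f (a g x).

Definition pattern_event r f (p : pattern E r k) : set X :=
  [set x | forall g : cayley_ball E r, f (a (val g) x) = p g].

(** Outside of the ball the value [j] is arbitrary: extended patterns are only
    given to functions supported on the ball. *)
Definition extend_pattern (j : 'I_k) r (p : pattern E r k) : G -> 'I_k :=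
  fun g => if insub g is Some h then p h else j.

Lemma extend_patternE j r (p : pattern E r k) (g : cayley_ball E r) :
  extend_pattern j p (val g) = p g.
Proof. by rewrite /extend_pattern valK. Qed.

Lemma measurable_act_preimage g A : measurable A -> measurable (a g @^-1` A).
Proof. by move=> mA; rewrite -[_ @^-1` _]setTI; exact: measurable_act. Qed.

Lemma measurable_pattern_event r f p : labelling f -> measurable (@pattern_event r f p).
Proof.
move=> mf.
have -> : pattern_event f p =
    \bigcap_(g in [set: cayley_ball E r]) (a (val g) @^-1` (f @^-1` [set p g])).
  by apply/seteqP; split => [x Sx g _|x Sx g]; [exact: Sx|exact: (Sx g)].
apply: fin_bigcap_measurable; first exact: finite_finset.
by move=> g _; exact: measurable_act_preimage.
Qed.

Lemma local_statE r f p : local_stat E a r f p = fine (mu (pattern_event f p)).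
Proof. by rewrite ffunE. Qed.

Lemma supported_extend V (F : seq G) (h : (G -> 'I_k) -> V) r f j x (p : pattern E r k) :
  supported_on F h -> {subset F <= cayley_ball E r} -> pattern_event f p x ->
  h (itinerary f x) = h (extend_pattern j p).
Proof.
move=> hF Fr px; apply: hF => g /Fr gr.
by rewrite -[g]/(val (FSetSub gr)) extend_patternE; exact: px.
Qed.

Lemma pattern_event_exists r f x : exists p : pattern E r k, pattern_event f p x.
Proof. by exists [ffun g => f (a (val g) x)] => g; rewrite ffunE. Qed.

Lemma pattern_event_uniq r f x (p q : pattern E r k) :
  pattern_event f p x -> pattern_event f q x -> p = q.
Proof. by move=> px qx; apply/ffunP => g; rewrite -px -qx. Qed.

Lemma cylinder_bigcup (F : seq G) (S : pred (G -> 'I_k)) r f j :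
  supported_on F S -> {subset F <= cayley_ball E r} ->
  [set x | S (itinerary f x)] =
  \bigcup_(p in [set` [seq p <- index_enum (pattern E r k) | S (extend_pattern j p)]])
    pattern_event f p.
Proof.
move=> SF Fr; apply/seteqP; split => x /=.
  move=> Sx; have [p px] := pattern_event_exists r f x; exists p => //=.
  by rewrite mem_filter mem_index_enum andbT -(supported_extend j SF Fr px).
by move=> [p /=]; rewrite mem_filter => /andP[Sp _] px; rewrite (supported_extend j SF Fr px).
Qed.

Lemma measurable_cylinder (F : seq G) (S : pred (G -> 'I_k)) f :
  marking E -> supported_on F S -> labelling f -> measurable [set x | S (itinerary f x)].
Proof.
move=> mE SF mf; have [r Fr] := cayley_ball_cover mE F.
rewrite (cylinder_bigcup f (f point) SF Fr); apply: fin_bigcup_measurable => // p _.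
exact: measurable_pattern_event.
Qed.

(** Disjointness of the pattern events turns the measure of a cylinder event
    into a partial sum of the local statistics. *)
Lemma cylinder_stat (F : seq G) (S : pred (G -> 'I_k)) r f j :
  supported_on F S -> {subset F <= cayley_ball E r} -> labelling f ->
  fine (mu [set x | S (itinerary f x)]) =
  \sum_(p | S (extend_pattern j p)) local_stat E a r f p.
Proof.
move=> SF Fr mf.
under eq_bigr do rewrite local_statE.
rewrite sum_fine => [|p _]; last by rewrite fin_num_measure//; exact: measurable_pattern_event.
rewrite -big_filter fsbig_seq ?filter_uniq ?index_enum_uniq// -measure_fin_bigcup//.
- by rewrite (cylinder_bigcup f j SF Fr).
- by move=> p q _ _ [x [/= xp xq]]; exact: pattern_event_uniq xp xq.
- by move=> p _; exact: measurable_pattern_event.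
Qed.

End cylinders.
Arguments itinerary {G R d X mu} a {T} f x.
Arguments pattern_event {G} E {R k d X mu} a {r} f p.

(** * Comparison of statistics in total variation *)

Section total_variation.
Context (R : realType) (T : finType).
Implicit Types p q : {ffun T -> R}.

Lemma tv_dist_event p q (A : pred T) :
  `|\sum_(t | A t) p t - \sum_(t | A t) q t| <= tv_dist p q.
Proof.
rewrite /tv_dist; have := @le_bigmax _ _ _ 0
  (fun A : {set T} => `|\sum_(t in A) p t - \sum_(t in A) q t|) [set t | A t]%SET.
by under eq_bigl do rewrite inE; under [in X in _ - X]eq_bigl do rewrite inE.
Qed.

Lemma tv_dist_le p q c : (forall A : {set T},
  `|\sum_(t in A) p t - \sum_(t in A) q t| <= c) -> tv_dist p q <= c.
Proof.
move=> pqc; apply: bigmax_le => //.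
by have := pqc finset.set0; rewrite !big_set0 subrr normr0.
Qed.

Lemma tv_distD p q s : tv_dist p s <= tv_dist p q + tv_dist q s.
Proof.
apply: tv_dist_le => A.
by rewrite (le_trans (ler_distD (\sum_(t in A) q t) _ _))// lerD// tv_dist_event.
Qed.

(** An excess of [p] over [q] on an event is, both masses being 1, a deficit on
    the complementary event. *)
Lemma tv_dist_le_onesided p q (c : R) : distribution_on p -> distribution_on q ->
  0 <= c -> (forall t, p t <= q t + c) -> tv_dist q p <= c *+ #|T|.
Proof.
move=> [p0 p1] [q0 q1] c0 pq.
have event (A : pred T) : \sum_(t | A t) p t - \sum_(t | A t) q t <= c *+ #|T|.
  rewrite -sumrB; apply: (@le_trans _ _ (\sum_(t | A t) c)).
    by apply: ler_sum => t _; rewrite lerBlDl.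
  by rewrite big_mkcond/= -sumr_const ler_sum// => t _; case: ifP.
apply: tv_dist_le => A; rewrite distrC ler_norml event andbT lerNl opprB.
have compl (s : {ffun T -> R}) : \sum_t s t = 1 ->
    \sum_(t in A) s t = 1 - \sum_(t | t \notin A) s t.
  by move=> <-; rewrite [X in _ = X - _](bigID (mem A))/= addrK.
rewrite (compl p)// (compl q)//.
have := event [pred t | t \notin A]; set u := \sum_(t | _) p t; set v := \sum_(t | _) q t.
by move=> /=; lra.
Qed.

End total_variation.

Section comparison.
Context (G : groupType) (E : {fset G}) (R : realType) (k : nat).
Context d (X : measurableType d) (mu : probability X R).
Context d' (Y : measurableType d') (nu : probability Y R).
Context (a : pmp_action G mu) (b : pmp_action G nu).

(** The error is measured at any radius [r] whose ball contains the support, so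
    one comparison at a large radius serves all smaller supports. *)
Lemma cylinder_close (F : seq G) (S : pred (G -> 'I_k)) r (f : X -> 'I_k) (g : Y -> 'I_k) :
  supported_on F S -> {subset F <= cayley_ball E r} -> labelling f -> labelling g ->
  `|fine (nu [set y | S (itinerary b g y)]) - fine (mu [set x | S (itinerary a f x)])|
    <= tv_dist (local_stat E b r g) (local_stat E a r f).
Proof.
move=> SF Fr mf mg.
rewrite (cylinder_stat b (f point) SF Fr mg) (cylinder_stat a (f point) SF Fr mf).
exact: tv_dist_event.
Qed.

(** The statistics at radius [N] have those at every smaller radius as marginals. *)
Lemma local_stat_cvg (f : nat -> X -> 'I_k) (g : Y -> 'I_k) :
  (forall N, labelling (f N)) -> labelling g ->
  (forall N, tv_dist (local_stat E b N g) (local_stat E a N (f N)) < N.+1%:R^-1) ->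
  forall r p, (fun N => local_stat E a r (f N) p) @ \oo --> local_stat E b r g p.
Proof.
move=> mf mg fg r p; apply/cvgrPdist_lt => e e0.
near=> N.
apply: (@le_lt_trans _ _ N.+1%:R^-1); last by near: N; exact: near_infty_natSinv_lt (PosNum e0).
apply: le_trans (ltW (fg N)).
pose S : pred (G -> 'I_k) := fun w => [forall h : cayley_ball E r, w (val h) == p h].
have SF : supported_on (cayley_ball E r) S.
  by move=> w w' ww'; apply: eq_forallb => h; rewrite ww'// fsvalP.
have statS dZ (Z : measurableType dZ) (la : probability Z R) (c : pmp_action G la)
    (h : Z -> 'I_k) :
    local_stat E c r h p = fine (la [set z | S (itinerary c h z)]).
  rewrite ffunE; congr (fine (la _)); apply/seteqP; split => z /=.
    by move=> zp; apply/forallP => x; apply/eqP; exact: zp.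
  by move=> /forallP zp x; apply/eqP; exact: zp.
have rN : (r <= N)%N by near: N; exact: nbhs_infty_ge.
rewrite !statS; apply: cylinder_close SF _ _ _ => // h.
exact: cayley_ball_mono.
Unshelve. all: by end_near.
Qed.

End comparison.

(** * Continuity of formulas *)

Section connectives.
Context (R : realType).

(** A uniformly continuous connective is continuous for entrywise convergence,
    balls of row vectors being products of balls. *)
Lemma unif_continuous_row_cvg m (c : 'rV[R]_m -> R) (u : 'I_m -> nat -> R) (v : 'I_m -> R) :
  unif_continuous c -> (forall j, u j @ \oo --> v j) ->
  (fun N => c (\row_j u j N)) @ \oo --> c (\row_j v j).
Proof.
move=> /unif_continuousP cc uv; apply/cvgrPdist_lt => e /cc[d /= d0 cd].
have /filterS : \forall N \near \oo, forall j, `|v j - u j N| < d.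
  by apply: filter_forall => j; move/cvgrPdist_lt : (uv j); exact.
apply => N uvN.
suff : ball (c (\row_j v j)) e (c (\row_j u j N)) by rewrite -ball_normE.
apply: (cd (_, _)); split => //= i j; rewrite !mxE -ball_normE.
exact: uvN.
Qed.

Context (G : groupType) (n : nat).
Context d (X : measurableType d) (mu : probability X R) (a : pmp_action G mu).
Context d' (Y : measurableType d') (nu : probability Y R) (b : pmp_action G nu).

(** Two actions are involved because the tuples [xs N] may live on another
    space than their limit [ys]. *)
Lemma formula_cvg (xs : nat -> 'I_n -> X -> R[i]) (ys : 'I_n -> Y -> R[i]) :
  (forall s t, (fun N => complex.Re (inner mu (term_val a (xs N) s) (term_val a (xs N) t)))
     @ \oo --> complex.Re (inner nu (term_val b ys s) (term_val b ys t))) ->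
  (forall s t, (fun N => complex.Im (inner mu (term_val a (xs N) s) (term_val a (xs N) t)))
     @ \oo --> complex.Im (inner nu (term_val b ys s) (term_val b ys t))) ->
  forall p, (fun N => formula_val a (xs N) p) @ \oo --> formula_val b ys p.
Proof.
move=> reC imC; elim=> [s t|s t|m c cc ps IH] /=; [exact: reC|exact: imC|].
exact: unif_continuous_row_cvg.
Qed.

End connectives.

Section integrals.
Context d (X : measurableType d) (R : realType) (mu : probability X R).
Implicit Types (u : nat -> X -> R) (v : X -> R).

Lemma Rintegral_sum (I : Type) (s : seq I) (u : I -> X -> R) :
  (forall i, mu.-integrable setT (EFin \o u i)) ->
  \int[mu]_x (\sum_(i <- s) u i x) = \sum_(i <- s) \int[mu]_x u i x.
Proof.
move=> iu; elim: s => [|i s IH].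
  under eq_Rintegral do rewrite big_nil.
  by rewrite big_nil Rintegral_cst// mul0r.
rewrite big_cons -IH -RintegralD//.
  by apply: eq_Rintegral => x _; rewrite big_cons.
rewrite (_ : EFin \o _ = fun x => (\sum_(i <- s) (EFin \o u i) x)%E).
  exact: integrable_sum.
by apply/funext => x /=; rewrite sumEFin.
Qed.

Lemma integrable_indicR A : measurable A -> mu.-integrable setT (EFin \o (\1_A : X -> R)).
Proof. exact: integrable_indic. Qed.

Lemma Rintegral_indicR A : measurable A -> \int[mu]_x (\1_A x) = fine (mu A).
Proof. by move=> mA; rewrite /Rintegral integral_indic// setIT. Qed.

(** Bounded almost everywhere convergence: the mode of convergence that is
    stable under the operations of terms and passes to integrals. *)
Definition bounded_cvg (u : nat -> X -> R) v :=
  [/\ forall N, measurable_fun setT (u N), measurable_fun setT v &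
      exists M : R, {ae mu, forall x,
        (forall N, `|u N x| <= M) /\ u ^~ x @ \oo --> v x}].

Lemma bounded_cvg_dominated u v : bounded_cvg u v ->
  mu.-integrable setT (EFin \o v) /\
  (fun N => \int[mu]_x u N x) @ \oo --> \int[mu]_x v x.
Proof.
move=> [mu_ mv [M uM]].
have [|||||intv _ cv] := @dominated_convergence _ _ _ mu setT measurableT
  (fun N => EFin \o u N) (EFin \o v) (cst M%:E).
- by move=> N; exact/measurable_EFinP.
- exact/measurable_EFinP.
- by apply: filterS uM => x [_ uv] _; apply: cvg_EFin; [exact: nearW|exact: uv].
- exact: finite_measure_integrable_cst.
- by apply: filterS uM => x [uM _] N _ /=; rewrite lee_fin.
split => //; apply: fine_cvg; rewrite fineK; last exact: integrable_fin_num.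
exact: cv.
Qed.

Lemma bounded_cvg_integrable u v : bounded_cvg u v -> mu.-integrable setT (EFin \o v).
Proof. by case/bounded_cvg_dominated. Qed.

Lemma bounded_cvg_Rintegral u v : bounded_cvg u v ->
  (fun N => \int[mu]_x u N x) @ \oo --> \int[mu]_x v x.
Proof. by case/bounded_cvg_dominated. Qed.

Lemma bounded_cvg_cst v (M : R) : measurable_fun setT v ->
  {ae mu, forall x, `|v x| <= M} -> bounded_cvg (fun=> v) v.
Proof.
move=> mv vM; split => //; exists M; apply: filterS vM => x vM; split => //.
exact: cvg_cst.
Qed.

Lemma bounded_cvgN u v : bounded_cvg u v ->
  bounded_cvg (fun N x => - u N x) (fun x => - v x).
Proof.
move=> [mu_ mv [M uM]]; split; [by move=> N; exact: measurableT_comp|exact: measurableT_comp|].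
exists M; apply: filterS uM => x [uM uv]; split; last exact: cvgN.
by move=> N; rewrite normrN.
Qed.

Lemma bounded_cvgD u v u' v' : bounded_cvg u v -> bounded_cvg u' v' ->
  bounded_cvg (fun N x => u N x + u' N x) (fun x => v x + v' x).
Proof.
move=> [mu_ mv [M uM]] [mu'_ mv' [M' uM']].
split; [by move=> N; exact: measurable_funD|exact: measurable_funD|].
exists (M + M'); apply: filterS2 uM uM' => x [uM uv] [uM' uv'].
split; last exact: cvgD.
by move=> N; rewrite (le_trans (ler_normD _ _))// lerD.
Qed.

Lemma bounded_cvgM u v u' v' : bounded_cvg u v -> bounded_cvg u' v' ->
  bounded_cvg (fun N x => u N x * u' N x) (fun x => v x * v' x).
Proof.
move=> [mu_ mv [M uM]] [mu'_ mv' [M' uM']].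
split; [by move=> N; exact: measurable_funM|exact: measurable_funM|].
exists (M * M'); apply: filterS2 uM uM' => x [uM uv] [uM' uv'].
split; last exact: cvgM.
by move=> N; rewrite normrM ler_pM.
Qed.

Context (G : groupType) (a : pmp_action G mu).

(** Invariance of the measure makes translates of null sets null. *)
Lemma ae_act (P : X -> Prop) g : {ae mu, forall x, P x} -> {ae mu, forall x, P (a g x)}.
Proof.
move=> [A [mA A0 PA]]; exists (a g @^-1` A); split.
- exact: measurable_act_preimage.
- by rewrite act_preserving.
- by move=> x /= nPx; exact: (PA (a g x)).
Qed.

Lemma bounded_cvg_act u v g : bounded_cvg u v ->
  bounded_cvg (fun N x => u N (a g x)) (fun x => v (a g x)).
Proof.
have mg := measurable_act a g.
move=> [mu_ mv [M uM]]; split.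
- by move=> N; exact: (measurableT_comp (mu_ N) mg).
- exact: (measurableT_comp mv mg).
- exists M; exact: (@ae_act (fun x => (forall N, `|u N x| <= M) /\ u ^~ x @ \oo --> v x)).
Qed.

Definition cbounded_cvg (u : nat -> X -> R[i]) (v : X -> R[i]) :=
  bounded_cvg (fun N x => complex.Re (u N x)) (fun x => complex.Re (v x)) /\
  bounded_cvg (fun N x => complex.Im (u N x)) (fun x => complex.Im (v x)).

Lemma cReD (z w : R[i]) : complex.Re (z + w) = complex.Re z + complex.Re w.
Proof. by case: z w => ? ? []. Qed.

Lemma cImD (z w : R[i]) : complex.Im (z + w) = complex.Im z + complex.Im w.
Proof. by case: z w => ? ? []. Qed.

Lemma cReM (z w : R[i]) : complex.Re (z * w) =
  complex.Re z * complex.Re w - complex.Im z * complex.Im w.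
Proof. by case: z w => ? ? []. Qed.

Lemma cImM (z w : R[i]) : complex.Im (z * w) =
  complex.Re z * complex.Im w + complex.Im z * complex.Re w.
Proof. by case: z w => ? ? []. Qed.

Lemma cReJ (z : R[i]) : complex.Re (z^*)%C = complex.Re z.
Proof. by case: z. Qed.

Lemma cImJ (z : R[i]) : complex.Im (z^*)%C = - complex.Im z.
Proof. by case: z. Qed.

Lemma cbounded_cvgM (u u' : nat -> X -> R[i]) (v v' : X -> R[i]) :
  cbounded_cvg u v -> cbounded_cvg u' v' ->
  cbounded_cvg (fun N x => u N x * u' N x) (fun x => v x * v' x).
Proof.
move=> [ru iu] [ru' iu']; split.
  under eq_fun do under eq_fun do rewrite cReM;
    under [X in bounded_cvg _ X]eq_fun do rewrite cReM.
  by apply: bounded_cvgD; [|apply: bounded_cvgN]; exact: bounded_cvgM.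
under eq_fun do under eq_fun do rewrite cImM;
  under [X in bounded_cvg _ X]eq_fun do rewrite cImM.
by apply: bounded_cvgD; exact: bounded_cvgM.
Qed.

Lemma cbounded_cvgJ (u : nat -> X -> R[i]) (v : X -> R[i]) : cbounded_cvg u v ->
  cbounded_cvg (fun N x => (u N x)^*%C) (fun x => (v x)^*%C).
Proof.
move=> [ru iu]; split.
  by under eq_fun do under eq_fun do rewrite cReJ;
    under [X in bounded_cvg _ X]eq_fun do rewrite cReJ.
under eq_fun do under eq_fun do rewrite cImJ;
  under [X in bounded_cvg _ X]eq_fun do rewrite cImJ.
exact: bounded_cvgN.
Qed.

Lemma cbounded_cvg_const (z : R[i]) : cbounded_cvg (fun _ _ => z) (fun=> z).
Proof.
by split; [apply: (@bounded_cvg_cst _ `|complex.Re z|)|apply: (@bounded_cvg_cst _ `|complex.Im z|)];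
  [exact: measurable_cst|exact: nearW|exact: measurable_cst|exact: nearW].
Qed.

(** With constant sequences, this says that terms preserve bounded measurable
    functions. *)
Lemma term_bounded_cvg n (us : nat -> 'I_n -> X -> R[i]) (vs : 'I_n -> X -> R[i]) :
  (forall i, cbounded_cvg (fun N => us N i) (vs i)) ->
  forall t, cbounded_cvg (fun N => term_val a (us N) t) (term_val a vs t).
Proof.
move=> uv; elim=> [i||s IHs t IHt|s IHs t IHt|t IHt|z t IHt|g t [rt it]] /=.
- exact: uv.
- exact: cbounded_cvg_const.
- case: IHs IHt => rs is_ [rt it]; split.
    under eq_fun do under eq_fun do rewrite cReD;
      under [X in bounded_cvg _ X]eq_fun do rewrite cReD.
    exact: bounded_cvgD.
  under eq_fun do under eq_fun do rewrite cImD;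
    under [X in bounded_cvg _ X]eq_fun do rewrite cImD.
  exact: bounded_cvgD.
- exact: cbounded_cvgM.
- exact: cbounded_cvgJ.
- by apply: cbounded_cvgM => //; exact: cbounded_cvg_const.
- by split; [exact: (bounded_cvg_act g^-1%g rt)|exact: (bounded_cvg_act g^-1%g it)].
Qed.

Lemma formula_bounded_cvg n (us : nat -> 'I_n -> X -> R[i]) (vs : 'I_n -> X -> R[i]) :
  (forall i, cbounded_cvg (fun N => us N i) (vs i)) ->
  forall p, (fun N => formula_val a (us N) p) @ \oo --> formula_val a vs p.
Proof.
move=> uv; apply: formula_cvg => s t.
  by apply: bounded_cvg_Rintegral; case: (cbounded_cvgM (term_bounded_cvg uv s)
    (cbounded_cvgJ (term_bounded_cvg uv t))).
by apply: bounded_cvg_Rintegral; case: (cbounded_cvgM (term_bounded_cvg uv s)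
  (cbounded_cvgJ (term_bounded_cvg uv t))).
Qed.

End integrals.

(** * Tuples of functions of a finite labelling *)

Section finitely_valued_tuples.
Context (G : groupType) (E : {fset G}) (markE : marking E) (R : realType) (k n : nat).
Variable v : 'I_k -> 'I_n -> R[i].

(** The value of a term at the tuple [v \o f] as a function of the itinerary
    of the labelling [f]. *)
Fixpoint itinerary_term (t : term G R n) (w : G -> 'I_k) : R[i] :=
  match t with
  | Var i => v (w 1%g) i
  | One => 1
  | Add s t => itinerary_term s w + itinerary_term t w
  | Mul s t => itinerary_term s w * itinerary_term t w
  | Star t => (itinerary_term t w)^*%C
  | Scale z t => z * itinerary_term t w
  | Act g t => itinerary_term t (fun h => w (h * g^-1)%g)
  end.

(** Each [Act g] translates the support by the inverse of [g]. *)
Lemma itinerary_term_supported t : exists F, supported_on F (itinerary_term t).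
Proof.
elim: t => [i||s [F sF] t [F' tF']|s [F sF] t [F' tF']|t [F tF]|z t [F tF]|g t [F tF]] /=.
- by exists [:: 1%g] => w w' ww' /=; rewrite ww'// inE.
- by exists [::].
- exists (F ++ F') => w w' ww' /=; congr (_ + _).
    by apply: sF => h hF; rewrite ww'// mem_cat hF.
  by apply: tF' => h hF; rewrite ww'// mem_cat hF orbT.
- exists (F ++ F') => w w' ww' /=; congr (_ * _).
    by apply: sF => h hF; rewrite ww'// mem_cat hF.
  by apply: tF' => h hF; rewrite ww'// mem_cat hF orbT.
- by exists F => w w' ww' /=; rewrite (tF w w').
- by exists F => w w' ww' /=; rewrite (tF w w').
- exists [seq (h * g^-1)%g | h <- F] => w w' ww' /=; apply: tF => h hF.
  by apply: ww'; exact: map_f.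
Qed.

Section one_action.
Context d (X : measurableType d) (mu : probability X R) (a : pmp_action G mu).
Implicit Type f : X -> 'I_k.

Lemma term_val_itinerary f t x :
  term_val a (fun i y => v (f y) i) t x = itinerary_term t (itinerary a f x).
Proof.
elim: t x => //= [i x|s IHs t IHt x|s IHs t IHt x|t IHt x|z t IHt x|g t IHt x].
- by rewrite /itinerary act1.
- by rewrite IHs IHt.
- by rewrite IHs IHt.
- by rewrite IHt.
- by rewrite IHt.
- rewrite IHt; congr itinerary_term; apply/funext => h.
  by rewrite /itinerary actM.
Qed.

Lemma inner_itinerary f s t :
  let h x := itinerary_term s (itinerary a f x) * (itinerary_term t (itinerary a f x))^*%C in
  inner mu (term_val a (fun i x => v (f x) i) s) (term_val a (fun i x => v (f x) i) t) =
  ((\int[mu]_x complex.Re (h x)) +i* (\int[mu]_x complex.Im (h x)))%C.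
Proof.
by rewrite /inner; congr (_ +i* _)%C; apply: eq_Rintegral => x _; rewrite !term_val_itinerary.
Qed.

(** A function supported on the ball of radius [r] is constant on each pattern
    event, so its integral is a finite sum weighted by the statistics. *)
Lemma Rintegral_itinerary (F : seq G) (h : (G -> 'I_k) -> R) r f j :
  supported_on F h -> {subset F <= cayley_ball E r} -> labelling f ->
  \int[mu]_x h (itinerary a f x) =
  \sum_p h (extend_pattern j p) * local_stat E a r f p.
Proof.
move=> hF Fr mf; have mp p := measurable_pattern_event (E := E) (r := r) a p mf.
transitivity (\int[mu]_x
    (\sum_(p : pattern E r k) h (extend_pattern j p) * \1_(pattern_event E a f p) x)).
  apply: eq_Rintegral => x _; have [p px] := pattern_event_exists E a r f x.
  rewrite (bigD1 (p : pattern E r k))//= big1 => [|q qp].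
    by rewrite indicE mem_set// mulr1 addr0; exact: (supported_extend j hF Fr px).
  rewrite indicE memNset ?mulr0// => qx.
  by move/eqP: qp; apply; exact: pattern_event_uniq qx px.
rewrite Rintegral_sum => [|p].
  apply: eq_bigr => p _.
  by rewrite RintegralZl ?Rintegral_indicR ?local_statE//; exact: integrable_indicR.
rewrite (_ : EFin \o _ = fun x =>
    ((h (extend_pattern j p))%:E * (\1_(pattern_event E a f p) x)%:E)%E).
  by apply: integrableZl => //; exact: integrable_indicR.
by apply/funext => x.
Qed.

End one_action.

Context d (X : measurableType d) (mu : probability X R).
Context d' (Y : measurableType d') (nu : probability Y R).
Context (a : pmp_action G mu) (b : pmp_action G nu).

(** The radius needed depends on the formula. As the labelling [f N] is controlled
    at radius [N], a single sequence serves all formulas. *)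
Lemma finitely_valued_formula_cvg (f : nat -> X -> 'I_k) (g : Y -> 'I_k) :
  (forall N, labelling (f N)) -> labelling g ->
  (forall N, tv_dist (local_stat E b N g) (local_stat E a N (f N)) < N.+1%:R^-1) ->
  forall p, (fun N => formula_val a (fun i x => v (f N x) i) p) @ \oo -->
    formula_val b (fun i y => v (g y) i) p.
Proof.
move=> mf mg fg.
have integral_cvg (h : (G -> 'I_k) -> R) F : supported_on F h ->
    (fun N => \int[mu]_x h (itinerary a (f N) x)) @ \oo -->
    \int[nu]_y h (itinerary b g y).
  move=> hF; have [r Fr] := cayley_ball_cover markE F.
  rewrite (Rintegral_itinerary b (g point) hF Fr mg).
  under eq_fun do rewrite (Rintegral_itinerary a (g point) hF Fr (mf _)).
  apply: cvg_big => [|p _]; [exact: add_continuous|apply: cvgM]; first exact: cvg_cst.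
  exact: (local_stat_cvg mf mg fg).
have support s t : exists F, forall c : R[i] -> R, supported_on F
    (fun w => c (itinerary_term s w * (itinerary_term t w)^*%C)).
  have [F sF] := itinerary_term_supported s; have [F' tF'] := itinerary_term_supported t.
  exists (F ++ F') => c w w' ww'; congr c; congr (_ * (_)^*%C).
    by apply: sF => h hF; rewrite ww'// mem_cat hF.
  by apply: tF' => h hF; rewrite ww'// mem_cat hF orbT.
apply: formula_cvg => s t; have [F cF] := support s t.
  rewrite inner_itinerary; under eq_fun do rewrite inner_itinerary.
  exact: (integral_cvg _ _ (cF (@complex.Re R))).
rewrite inner_itinerary; under eq_fun do rewrite inner_itinerary.
exact: (integral_cvg _ _ (cF (@complex.Im R))).
Qed.

End finitely_valued_tuples.

Section discretization.
Context (R : realType) (N : nat).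

(** The index of the largest point of the grid of mesh [1 / N.+1] on
    [[-N.+1, N.+1]] below [r], the nearest end of the grid when [r] is outside. *)
Definition grid_index (r : R) : 'I_(2 * N.+1 * N.+1).+1 :=
  inord (minn (Num.truncn ((r + N.+1%:R) * N.+1%:R)) (2 * N.+1 * N.+1)).

Definition grid_point (j : 'I_(2 * N.+1 * N.+1).+1) : R := j%:R / N.+1%:R - N.+1%:R.

Lemma grid_indexE r :
  (grid_index r : nat) = minn (Num.truncn ((r + N.+1%:R) * N.+1%:R)) (2 * N.+1 * N.+1).
Proof. by rewrite inordK// ltnS geq_minr. Qed.

Lemma grid_point_in r : `|r| <= N.+1%:R -> `|grid_point (grid_index r) - r| <= N.+1%:R^-1.
Proof.
rewrite ler_norml => /andP[rl ru]; have N0 : (0 : R) < N.+1%:R by [].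
set y := (r + N.+1%:R) * N.+1%:R.
have y0 : 0 <= y by rewrite mulr_ge0//; lra.
have /andP[ty yt] := truncn_itv y0.
have yK : y <= (2 * N.+1 * N.+1)%:R by rewrite !natrM ler_pM2r//; lra.
have -> : grid_point (grid_index r) = (Num.truncn y)%:R / N.+1%:R - N.+1%:R.
  rewrite /grid_point grid_indexE (minn_idPl _)//.
  by rewrite -(ler_nat R) (le_trans ty).
have -> : (Num.truncn y)%:R / N.+1%:R - N.+1%:R - r = ((Num.truncn y)%:R - y) / N.+1%:R.
  by rewrite mulrBl /y mulfK ?gt_eqF// opprD addrA addrAC.
rewrite normrM normfV (gtr0_norm N0) ler_pdivrMr// mulVf ?gt_eqF//.
by rewrite ler_norml; move: ty yt; rewrite -natr1; lra.
Qed.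

(** Clamping to the grid keeps the discretized functions bounded uniformly in
    [N], as required by dominated convergence. *)
Lemma grid_point_le r : `|grid_point (grid_index r)| <= `|r| + 1.
Proof.
have N0 : (0 : R) < N.+1%:R by [].
have [rN|rN] := lerP `|r| N.+1%:R.
  have := grid_point_in rN; rewrite -{2}[grid_point _](subrK r) => grN.
  rewrite (le_trans (ler_normD _ _))// addrC lerD2l (le_trans grN)//.
  by rewrite invf_le1// ler1n.
apply: (@le_trans _ _ N.+1%:R); last by rewrite ler_wpDr// ltW.
have jK : ((grid_index r)%:R : R) <= (2 * N.+1 * N.+1)%:R.
  by rewrite ler_nat -ltnS.
rewrite ler_norml /grid_point lerBlDr lerDr divr_ge0//= ler_pdivrMr//.
by move: jK; rewrite !natrM; lra.
Qed.

(** The sets where the index exceeds [m] are given by inequalities between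
    measurable functions, and level sets are differences of them. *)
Lemma measurable_grid_index d (X : measurableType d) (u : X -> R) j :
  measurable_fun setT u -> measurable [set x | grid_index (u x) = j].
Proof.
move=> mu_; set K := (2 * N.+1 * N.+1)%N.
pose y x := (u x + N.+1%:R) * N.+1%:R.
have my : measurable_fun setT y.
  by apply: measurable_funM => //; exact: measurable_funD.
have ge_measurable m : measurable [set x | (m < grid_index (u x))%N].
  have [mK|Km] := ltnP m K; last first.
    rewrite (_ : mkset _ = set0)//; apply/seteqP; split => // x /=.
    by rewrite grid_indexE leq_min => /andP[_]; rewrite ltnNge Km.
  rewrite (_ : mkset _ = setT `&` [set x | m.+1%:R <= y x]).
    exact: measurable_fun_le.
  apply/seteqP; split => x /=.
    by rewrite grid_indexE leq_min truncn_gt_nat => /andP[].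
  by rewrite grid_indexE leq_min truncn_gt_nat mK andbT => -[].
have -> : [set x | grid_index (u x) = j] =
    [set x | (j <= grid_index (u x))%N] `\` [set x | (j < grid_index (u x))%N].
  apply/seteqP; split => x /=; first by move=> <-; rewrite ltnn leqnn.
  by move=> [ju /negP]; rewrite -leqNgt => uj; apply/val_inj/eqP; rewrite eqn_leq uj ju.
apply: measurableD => //; case: (nat_of_ord j) => [|m]; last exact: ge_measurable.
by rewrite (_ : mkset _ = setT)//; apply/seteqP; split.
Qed.

End discretization.

Lemma grid_cvg (R : realType) (r : R) :
  (fun N => grid_point R (grid_index N r)) @ \oo --> r.
Proof.
apply/cvgrPdist_lt => e e0; near=> N.
rewrite distrC (@le_lt_trans _ _ N.+1%:R^-1)//.
  apply: grid_point_in.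
  have : (Num.truncn `|r| <= N)%N by near: N; exact: nbhs_infty_ge.
  by rewrite truncn_le_nat => /ltW.
by near: N; exact: near_infty_natSinv_lt (PosNum e0).
Unshelve. all: by end_near.
Qed.

Lemma Linfty_labelling (R : realType) d (X : measurableType d) (mu : probability X R)
    k (f : X -> 'I_k) (v : 'I_k -> R[i]) : labelling f -> Linfty mu (fun x => v (f x)).
Proof.
move=> mf; have part (c : R[i] -> R) : measurable_fun setT (fun x => c (v (f x))).
  rewrite (_ : (fun x => _) = (fun x => \sum_j c (v j) * \1_(f @^-1` [set j]) x)).
    by apply: measurable_sum => j; apply: measurable_funM => //; apply: measurable_indic; exact: mf.
  apply/funext => x; rewrite (bigD1 (f x))//= big1 => [|j jx].
    by rewrite indicE mem_set// mulr1 addr0.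
  by rewrite indicE memNset ?mulr0// => /= xj; rewrite xj eqxx in jx.
split; [exact: part|exact: part|].
exists (\big[Num.max/0]_j ComplexField.Normc.normc (v j)); apply: nearW => x.
exact: (le_bigmax _ (fun j => ComplexField.Normc.normc (v j))).
Qed.

Section approximation.
Context (R : realType) d (X : measurableType d) (mu : probability X R) (n : nat).

(** The real and imaginary parts are rounded to finer and finer grids; the grid
    indices of all members of the tuple together form one label. *)
Lemma finitely_valued_approx (xs : 'I_n -> X -> R[i]) : (forall i, Linfty mu (xs i)) ->
  exists (k : nat -> nat) (f : forall N, X -> 'I_(k N))
    (v : forall N, 'I_(k N) -> 'I_n -> R[i]),
    (forall N, labelling (f N)) /\
    forall i, cbounded_cvg mu (fun N x => v N (f N x) i) (xs i).
Proof.
move=> Lxs.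
pose J N := 'I_(2 * N.+1 * N.+1).+1.
pose T N : finType := {ffun 'I_n -> J N * J N}.
pose code N x : T N :=
  [ffun i => (grid_index N (complex.Re (xs i x)), grid_index N (complex.Im (xs i x)))].
exists (fun N => #|T N|), (fun N x => enum_rank (code N x)),
  (fun N j i => let q := (enum_val j : T N) i in (grid_point R q.1 +i* grid_point R q.2)%C).
split => [N j|i].
  rewrite (_ : _ @^-1` _ = \bigcap_(i in [set: 'I_n])
    ([set x | grid_index N (complex.Re (xs i x)) = ((enum_val j : T N) i).1] `&`
     [set x | grid_index N (complex.Im (xs i x)) = ((enum_val j : T N) i).2])).
    apply: fin_bigcap_measurable; first exact: finite_finset.
    by move=> i _; have [mr mi _] := Lxs i; apply: measurableI; exact: measurable_grid_index.
  apply/seteqP; split => x /=.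
    by move=> <- i _; rewrite enum_rankK ffunE.
  move=> jx; rewrite -[RHS]enum_valK; congr enum_rank; apply/ffunP => i.
  by rewrite ffunE; have [/= -> ->] := jx i I; case: (_ i).
have [mr mi [M xM]] := Lxs i.
have part (c : R[i] -> R) : (forall z, `|c z| <= ComplexField.Normc.normc z) ->
    measurable_fun setT (fun x => c (xs i x)) ->
    bounded_cvg mu (fun N x => grid_point R (grid_index N (c (xs i x)))) (fun x => c (xs i x)).
  move=> cle mc; split => //.
    move=> N; rewrite (_ : (fun x => _) = (fun x => \sum_(j : J N)
        grid_point R j * \1_[set x | grid_index N (c (xs i x)) = j] x)).
      apply: measurable_sum => j; apply: measurable_funM => //.
      exact/measurable_indic/measurable_grid_index.
    apply/funext => x; rewrite (bigD1 (grid_index N (c (xs i x))))//= big1 => [|j jx].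
      by rewrite indicE mem_set// mulr1 addr0.
    by rewrite indicE memNset ?mulr0// => /= xj; rewrite xj eqxx in jx.
  exists (M + 1); apply: filterS xM => x xM; split; last exact: grid_cvg.
  by move=> N; rewrite (le_trans (grid_point_le _ _))// lerD2r (le_trans (cle _)).
have sqrt_le (p q : R) : `|p| <= Num.sqrt (p ^+ 2 + q ^+ 2).
  by rewrite -sqrtr_sqr ler_wsqrtr// lerDl sqr_ge0.
split.
  under eq_fun do under eq_fun do rewrite enum_rankK ffunE.
  by apply: (part (@complex.Re R)) => // -[p q]; exact: sqrt_le.
under eq_fun do under eq_fun do rewrite enum_rankK ffunE.
by apply: (part (@complex.Im R)) => // -[p q] /=; rewrite addrC; exact: sqrt_le.
Qed.

End approximation.

(** * From statistics to sentences *)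

Section statistics_to_sentences.
Context (R : realType) (G : groupType) (E : {fset G}) (markE : marking E).
Context d (X : measurableType d) (mu : probability X R) (a b : pmp_action G mu).

Lemma local_statistics_approx :
  (forall r k, local_statistics E b r k `<=` local_statistics E a r k) ->
  forall r k (g : X -> 'I_k) (e : R), labelling g -> 0 < e ->
  exists2 f : X -> 'I_k, labelling f &
    tv_dist (local_stat E b r g) (local_stat E a r f) < e.
Proof.
move=> ba r k g e mg e0.
have [|_ /(_ e e0)//] := ba r k (local_stat E b r g).
split=> [|c c0]; first exact: local_stat_distribution.
exists g => //; apply: le_lt_trans c0; apply: tv_dist_le => A.
by rewrite subrr normr0.
Qed.

Lemma sigma1_set_has_inf (phi : sigma1_sentence G R) (c : pmp_action G mu) :
  standard_borel R X ->
  has_inf [set formula_val c xs (sigma1_body phi) |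
     xs in [set xs | forall i, Linfty mu (xs i)]].
Proof.
move=> sX; split.
  exists (formula_val c (fun _ _ => 0) (sigma1_body phi)), (fun _ _ => 0) => //= i.
  split; [exact: measurable_cst|exact: measurable_cst|].
  by exists (ComplexField.Normc.normc (0 : R[i])); exact: nearW.
have [m mP] := sigma1_bounded phi; exists m => _ [xs Lxs <-].
exact: mP.
Qed.

(** The infimum for [a] is at most the value for [b] at a tuple of functions of a
    finite labelling, this value being a limit of values for [a]; and these tuples
    approximate all others. *)
Lemma local_statistics_sigma1 : standard_borel R X ->
  (forall r k, local_statistics E b r k `<=` local_statistics E a r k) ->
  forall phi : sigma1_sentence G R, sigma1_val a phi <= sigma1_val b phi.
Proof.
move=> sX ba phi; apply: lb_le_inf; first exact: (sigma1_set_has_inf _ b sX).1.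
move=> _ [xs Lxs <-].
have [k [f [v [mf fv]]]] := finitely_valued_approx Lxs.
have xs_cvg := formula_bounded_cvg (a := b) (us := fun N i x => v N (f N x) i) fv
  (p := sigma1_body phi).
apply: (cvgr_to_ge xs_cvg); apply: nearW => N.
have /choice[f' f'P] M : exists f' : X -> 'I_(k N), labelling f' /\
    tv_dist (local_stat E b M (f N)) (local_stat E a M f') < M.+1%:R^-1.
  by have [//|f' ? ?] := @local_statistics_approx ba M _ _ M.+1%:R^-1 (mf N); exists f'.
have f'_cvg := finitely_valued_formula_cvg markE (v := v N) (fun M => (f'P M).1) (mf N)
  (fun M => (f'P M).2) (p := sigma1_body phi).
apply: (cvgr_to_ge f'_cvg); apply: nearW => M.
apply: ge_inf; first exact: (sigma1_set_has_inf _ a sX).2.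
exists (fun i x => v N (f' M x) i) => //= i.
exact: (Linfty_labelling mu (fun j => v N j i) (f'P M).1).
Qed.

End statistics_to_sentences.

(** * Sentences about square norms *)

Section square_norms.
Context (R : realType).

Definition sqnormc (z : R[i]) : R := complex.Re z ^+ 2 + complex.Im z ^+ 2.

Lemma sqnormc_ge0 z : 0 <= sqnormc z.
Proof. by rewrite addr_ge0// sqr_ge0. Qed.

Lemma sqnormcM z w : sqnormc (z * w) = sqnormc z * sqnormc w.
Proof. by rewrite /sqnormc cReM cImM; ring. Qed.

Lemma sqnormc_prod (I : Type) (s : seq I) (z : I -> R[i]) :
  sqnormc (\prod_(i <- s) z i) = \prod_(i <- s) sqnormc (z i).
Proof.
elim: s => [|i s IH]; last by rewrite !big_cons sqnormcM IH.
by rewrite !big_nil /sqnormc /= expr1n expr0n addr0.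
Qed.

(** If none of the [z i] has modulus at least [h], this bounds the product of the
    [1 - z i] away from 0. *)
Lemma sqnormc_1sub z (h : R) : 0 <= h <= 1 -> sqnormc z < h ^+ 2 ->
  (1 - h) ^+ 2 <= sqnormc (1 - z).
Proof.
move=> h01 zh; rewrite /sqnormc cReD cImD.
have reh : complex.Re z < h.
  rewrite ltNge; apply/negP => hz; move: zh; apply/negP; rewrite -leNgt.
  by rewrite /sqnormc -[leLHS]addr0 lerD ?sqr_ge0// lerXn2r ?nnegrE//; lra.
have -> : complex.Re (- z) = - complex.Re z by case: (z).
rewrite -[leLHS]addr0 lerD ?sqr_ge0// lerXn2r ?nnegrE /=; lra.
Qed.

Context d (X : measurableType d) (mu : probability X R).

Lemma Re_inner_diag (u : X -> R[i]) :
  complex.Re (inner mu u u) = \int[mu]_x sqnormc (u x).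
Proof.
apply: eq_Rintegral => x _; rewrite cReM cReJ cImJ mulrN opprK.
by rewrite /sqnormc !expr2.
Qed.

(** The form of the union bound used below: [P] is contained in [C] up to a few
    exceptional sets [A i]. *)
Lemma measure_le_sum (I : finType) (P C : set X) (A : I -> set X) :
  measurable P -> measurable C -> (forall i, measurable (A i)) ->
  (forall x, P x -> C x \/ exists i, A i x) ->
  fine (mu P) <= fine (mu C) + \sum_i fine (mu (A i)).
Proof.
move=> mP mC mA PCA.
have iA : mu.-integrable setT (EFin \o (fun x => \sum_i \1_(A i) x)).
  rewrite (_ : EFin \o _ = fun x => (\sum_i (EFin \o (\1_(A i) : X -> R)) x)%E).
    by apply: integrable_sum => // i _; exact: integrable_indicR.
  by apply/funext => x /=; rewrite sumEFin.
rewrite -!Rintegral_indicR//; under eq_bigr do rewrite -Rintegral_indicR//.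
rewrite -Rintegral_sum; last by move=> i; exact: integrable_indicR.
rewrite -RintegralD//; last exact: integrable_indicR.
apply: le_Rintegral => //; first exact: integrable_indicR.
  rewrite (_ : EFin \o _ = fun x => (((\1_C x)%:E + (\sum_i \1_(A i) x)%:E))%E)//.
  by apply: integrableD => //; exact: integrable_indicR.
move=> x _; have ind0 i : 0 <= (\1_(A i) x : R) by rewrite indicE ler0n.
have [Px|nPx] := pselect (P x); last first.
  by rewrite indicE memNset//= addr_ge0// sumr_ge0.
rewrite [leLHS]indicE mem_set//.
have [Cx|[i Aix]] := PCA x Px.
  by rewrite indicE mem_set// lerDl sumr_ge0.
rewrite (bigD1 i)//= [\1_(A i) x]indicE mem_set// addrCA lerDl addr_ge0//.
by rewrite sumr_ge0.
Qed.

Lemma markov_Rintegral (h : X -> R) (c : R) : mu.-integrable setT (EFin \o h) ->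
  measurable_fun setT h -> (forall x, 0 <= h x) ->
  c * fine (mu [set x | c <= h x]) <= \int[mu]_x h x.
Proof.
move=> ih mh h0.
have mA : measurable [set x | c <= h x].
  by rewrite -[mkset _]setTI; exact: measurable_fun_le.
rewrite -Rintegral_indicR// -RintegralZl//; last exact: integrable_indicR.
apply: le_Rintegral => //.
  rewrite (_ : EFin \o _ = fun x => (c%:E * (\1_[set x | c <= h x] x)%:E)%E)//.
  by apply: integrableZl => //; exact: integrable_indicR.
move=> x _; rewrite indicE; have [cx|cx] := pselect (c <= h x).
  by rewrite mem_set// mulr1.
by rewrite memNset// mulr0.
Qed.

Context (G : groupType) (n : nat) (a : pmp_action G mu).

Lemma Linfty_sqnorm_term (xs : 'I_n -> X -> R[i]) (t : term G R n) :
  (forall i, Linfty mu (xs i)) ->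
  measurable_fun setT (fun x => sqnormc (term_val a xs t x)) /\
  mu.-integrable setT (EFin \o (fun x => sqnormc (term_val a xs t x))).
Proof.
move=> Lxs.
have xs_cvg i : cbounded_cvg mu (fun=> xs i) (xs i).
  have [mr mi [M xM]] := Lxs i.
  have le_norm (z : R[i]) : `|complex.Re z| <= ComplexField.Normc.normc z /\
      `|complex.Im z| <= ComplexField.Normc.normc z.
    by case: z => p q /=; rewrite -!sqrtr_sqr; split;
      rewrite ler_wsqrtr// ?lerDl ?lerDr ?sqr_ge0.
  by split; apply: (@bounded_cvg_cst _ _ _ _ _ M) => //; apply: filterS xM => x;
    apply: le_trans; case: (le_norm (xs i x)).
have [rt it] := term_bounded_cvg (us := fun=> xs) a xs_cvg t.
have := bounded_cvgD (bounded_cvgM rt rt) (bounded_cvgM it it).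
under [X in bounded_cvg _ _ X]eq_fun do rewrite -!expr2.
move=> bt; split; first by case: bt.
exact: bounded_cvg_integrable bt.
Qed.

End square_norms.

(** The sentence asking for a tuple at which the square norm of each term [t j]
    is close to [q j]. *)
Section deviation_sentences.
Context (R : realType) (G : groupType) (n : nat) (J : finType).
Variables (t : J -> term G R n) (q : J -> R).

Definition deviation_connective (v : 'rV[R]_#|J|) : R :=
  \sum_i `|v ord0 i - q (enum_val i)|.

Lemma deviation_connective_unif : unif_continuous deviation_connective.
Proof.
apply/unif_continuousP => e e0.
exists (e / #|J|.+1%:R) => [|[v w] [_ /= vw]]; first by rewrite divr_gt0.
rewrite -ball_normE/= /deviation_connective -sumrB.
rewrite (le_lt_trans (ler_norm_sum _ _ _))//.
apply: (@le_lt_trans _ _ (\sum_(i < #|J|) e / #|J|.+1%:R)).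
  apply: ler_sum => i _; rewrite (le_trans (ler_dist_dist _ _))//.
  rewrite opprB addrA subrK; apply: ltW.
  by have := vw ord0 i; rewrite -ball_normE.
rewrite sumr_const card_ord -[_ *+ #|J|]mulr_natr -mulrA gtr_pMr//.
by rewrite mulrC ltr_pdivrMr// mul1r ltr_nat.
Qed.

Definition deviation : formula G R n :=
  Connective deviation_connective_unif
    (fun i => ReInner (t (enum_val i)) (t (enum_val i))).

Lemma deviation_val d (X : measurableType d) (mu : probability X R)
    (a : pmp_action G mu) xs :
  formula_val a xs deviation =
  \sum_j `|\int[mu]_x sqnormc (term_val a xs (t j) x) - q j|.
Proof.
rewrite /= /deviation_connective.
rewrite (reindex (@enum_val J J))/=; last exact/onW_bij/enum_val_bij.
by apply: eq_bigr => i _; rewrite mxE -Re_inner_diag.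
Qed.

Lemma deviation_bounded : bounded_below deviation.
Proof.
exists 0 => d X mu a xs _ _.
by rewrite deviation_val sumr_ge0.
Qed.

Definition deviation_sentence : sigma1_sentence G R := Sigma1 deviation_bounded.

End deviation_sentences.

(** * From sentences to statistics *)

Lemma sqr_exprn_itv (R : realFieldType) m (h : R) : 0 < h -> h < 1 ->
  0 < ((1 - h) ^+ 2) ^+ m <= 1.
Proof.
move=> h0 h1; have h01 : 0 < 1 - h by lra.
by rewrite !exprn_gt0//= !exprn_ile1 ?exprn_ge0 ?ltW//; lra.
Qed.

(** The error terms of the rounding below, made smaller than [eps]: first [h] is
    chosen close to [1], then [e] small with respect to [h]. *)
Lemma rounding_budget (R : realFieldType) (n m : nat) (eps : R) : 0 < eps ->
  exists h e, [/\ 0 < h < 1, 0 < e & forall q : R, 0 <= q <= 1 ->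
    (q + e) / h ^+ 2 + (e / (((1 - h) ^+ 2) ^+ n * (h ^+ 2 * h ^+ 2))) *+ m <= q + eps].
Proof.
move=> eps0.
(* with [h = (1 + s)^-1] the factor [h ^- 2] costs at most [3 * s] *)
pose s := Num.min 1 (eps / 6).
have s0 : 0 < s by rewrite lt_min ltr01 divr_gt0.
have s1 : s <= 1 by rewrite ge_min lexx.
have s6 : s <= eps / 6 by rewrite ge_min lexx orbT.
clearbody s; pose h := (1 + s)^-1; have s10 : 0 < 1 + s by rewrite addr_gt0.
have /andP[h0 h1] : 0 < h < 1 by rewrite invr_gt0 s10 invf_lt1// ltrDl.
pose c := ((1 - h) ^+ 2) ^+ n * (h ^+ 2 * h ^+ 2).
have c0 : 0 < c by rewrite !mulr_gt0// !exprn_gt0// subr_gt0.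
pose e := eps / 2 / (4 + m%:R / c).
have den0 : 0 < 4 + m%:R / c by rewrite ltr_wpDr// divr_ge0// ltW.
have e0 : 0 < e by rewrite !divr_gt0.
exists h, e; split => [|//|q /andP[q0 q1]]; first by rewrite h0.
have ec : e * 4 + e / c *+ m = eps / 2.
  rewrite -[_ *+ m]mulr_natr -mulrA -mulrDr [c^-1 * _]mulrC.
  by rewrite /e -mulrA mulVf ?mulr1// gt_eqF.
have -> : (q + e) / h ^+ 2 = (q + e) * (1 + s) ^+ 2 by rewrite /h exprVn invrK.
rewrite -/c; move: (e / c *+ m) ec => x ec; move: (e) e0 ec => {}e e0 ec.
have s2 : (1 + s) ^+ 2 <= 1 + 3 * s.
  have -> : (1 + s) ^+ 2 = 1 + 2 * s + s * s by ring.
  by have : s * s <= s * 1 by [rewrite ler_wpM2l// ltW]; lra.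
have : (q + e) * (1 + s) ^+ 2 <= (q + e) * (1 + 3 * s).
  by rewrite ler_wpM2l// addr_ge0// ltW.
have qs : q * s <= 1 * s by rewrite ler_wpM2r// ltW.
have es : e * s <= e * 1 by rewrite ler_wpM2l// ltW.
have -> : (q + e) * (1 + 3 * s) = q + e + 3 * (q * s) + 3 * (e * s) by ring.
by move: (_ * (1 + s) ^+ 2) => y; lra.
Qed.

Section pattern_sentence.
Context (R : realType) (G : groupType) (E : {fset G}) (r k : nat).
Notation T := (pattern E r k).
Notation B := (cayley_ball E r).

Definition ball_one : B := [` one_cayley_ball E r]%fset.

(** The patterns [c.1.1] at a point and [c.2] at its translate by [c.1.2] give
    different labels to that translate. *)
Definition conflict (c : T * B * T) : bool := c.1.1 c.1.2 != c.2 ball_one.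

Definition pattern_var (p : T) : term G R #|T| := Var G R (enum_rank p).

(** The product of the [1 - x_p], which vanishes where some pattern is seen. *)
Definition cover_term : term G R #|T| :=
  foldr (@Mul G R #|T|) (One G R #|T|)
    [seq Add (One G R #|T|) (Scale (-1) (pattern_var p)) | p <- enum T].

(** At indicators, the square norm of the product is the measure of the points with pattern
    [c.1.1] whose translate by [c.1.2] has pattern [c.2].
    The zero term stands for compatible patterns, to keep the index set a product. *)
Definition conflict_term (c : T * B * T) : term G R #|T| :=
  if conflict c then Mul (pattern_var c.1.1) (Act (val c.1.2)^-1%g (pattern_var c.2))
  else Scale 0 (One G R #|T|).

(** At the tuple of the indicators of the patterns of a labelling with
    statistics [q], these terms have the square norms [condition_target q]. *)
Definition condition_term (j : T + option (T * B * T)) : term G R #|T| :=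
  match j with
  | inl p => pattern_var p
  | inr None => cover_term
  | inr (Some c) => conflict_term c
  end.

Definition condition_target (q : {ffun T -> R}) (j : T + option (T * B * T)) : R :=
  if j is inl p then q p else 0.

Arguments cover_term : simpl never.
Arguments conflict_term : simpl never.

Section values.
Context d (X : measurableType d) (mu : probability X R) (a : pmp_action G mu).
Implicit Type xs : 'I_#|T| -> X -> R[i].

Lemma cover_term_val xs x :
  term_val a xs cover_term x = \prod_(p <- enum T) (1 - xs (enum_rank p) x).
Proof.
rewrite /cover_term; elim: (enum T) => [|p s IH] /=; first by rewrite big_nil.
by rewrite big_cons IH mulN1r.
Qed.

Lemma conflict_term_val xs c x : conflict c ->
  term_val a xs (conflict_term c) x =
  xs (enum_rank c.1.1) x * xs (enum_rank c.2) (a (val c.1.2) x).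
Proof. by rewrite /conflict_term => -> /=; rewrite invgK. Qed.

(** Every point sees exactly one pattern, and patterns seen at a point and at a
    translate of it never conflict. *)
Lemma pattern_conditions_indicator (g : X -> 'I_k) : labelling g ->
  exists2 xs, forall i, Linfty mu (xs i) &
    formula_val a xs (deviation condition_term (condition_target (local_stat E a r g))) = 0.
Proof.
move=> mg; pose code x : T := [ffun h => g (a (val h) x)].
have codeE x p : pattern_event E a g p x -> code x = p.
  by move=> px; apply/ffunP => h; rewrite ffunE; exact: px.
have codeP x : pattern_event E a g (code x) x by move=> h; rewrite ffunE.
pose xs (i : 'I_#|T|) x : R[i] := (enum_val i == code x)%:R.
have xsE p x : xs (enum_rank p) x = (p == code x)%:R by rewrite /xs enum_rankK.
have sqn (c : bool) : sqnormc (c%:R : R[i]) = c%:R.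
  by case: c; rewrite /sqnormc/= ?expr1n ?expr0n/= addr0.
exists xs.
  have mcode : labelling (fun x => enum_rank (code x)).
    move=> j; rewrite (_ : _ @^-1` _ = pattern_event E a g (enum_val j)).
      exact: measurable_pattern_event.
    apply/seteqP; split => x /=; first by move=> <-; rewrite enum_rankK.
    by move=> /codeE ->; rewrite enum_valK.
  move=> i; have := Linfty_labelling mu (fun j => (enum_val i == enum_val j)%:R : R[i]) mcode.
  by under [X in Linfty _ X -> _]eq_fun do rewrite enum_rankK.
have int0 (u : X -> R) : (forall x, u x = 0) -> `|\int[mu]_x u x - 0| = 0.
  move=> u0; under eq_Rintegral do rewrite u0.
  by rewrite Rintegral_cst// mul0r subr0 normr0.
rewrite deviation_val; apply: big1 => -[p|[c|]] _ /=.
- rewrite local_statE -Rintegral_indicR; last exact: measurable_pattern_event.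
  rewrite (_ : \int[mu]_x _ = \int[mu]_x (\1_(pattern_event E a g p) x)) ?subrr ?normr0//.
  apply: eq_Rintegral => x _; rewrite xsE sqn indicE; congr ((nat_of_bool _)%:R).
  by apply/idP/idP => [/eqP->|/set_mem/codeE->//]; exact/mem_set.
- apply: int0 => x; have [cc|nc] := boolP (conflict c); last first.
    by rewrite /conflict_term (negPf nc)/= mul0r (sqn false).
  rewrite conflict_term_val// !xsE -natrM mulnb sqn.
  case: eqP => //= c1; case: eqP => //= c2; move: cc.
  by rewrite /conflict c1 c2 !ffunE /= act1 eqxx.
- apply: int0 => x; rewrite cover_term_val (bigD1_seq (code x)) ?enum_uniq ?mem_enum//=.
  by rewrite xsE eqxx subrr mul0r (sqn false).
Qed.

(** Say that [x] sees [p] if the function of the pattern [p] has modulus at least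
    [h] at [x]. Where no pattern is seen the squared modulus of [cover_term] is at least
    [((1 - h) ^+ 2) ^+ #|T|], and where conflicting patterns are seen that of
    [conflict_term] is at least [h ^+ 4]; by Markov's inequality, both happen rarely.
    The label of a point is the value at 1 of a pattern seen there. Away from the
    exceptional points, a point with pattern [p] for the new labelling sees [p],
    because any pattern [p1] seen at [x] has, for each [g], no conflict with the
    pattern seen at [g x], whose value at 1 is the label of [g x]; hence [p1 = p].
    Finally the points that see [p] have measure at most the square norm of the
    function of [p] divided by [h ^+ 2]. *)
Lemma pattern_conditions_round (q : {ffun T -> R}) xs (h e : R) :
  0 < h < 1 -> 0 <= e -> (k > 0)%N -> (forall i, Linfty mu (xs i)) ->
  formula_val a xs (deviation condition_term (condition_target q)) <= e ->
  exists2 f : X -> 'I_k, labelling f & forall p, local_stat E a r f p <=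
    (q p + e) / h ^+ 2 +
    (e / (((1 - h) ^+ 2) ^+ #|T| * (h ^+ 2 * h ^+ 2))) *+ #|{: B + T * B * T}|.
Proof.
move=> /andP[h0 h1] e0 k0 Lxs dev.
have cond j : \int[mu]_x sqnormc (term_val a xs (condition_term j) x) <= condition_target q j + e.
  rewrite -lerBlDl (le_trans (ler_norm _))// (le_trans _ dev)//.
  by rewrite deviation_val (bigD1 j)//= lerDl sumr_ge0.
pose C p := [set x | h ^+ 2 <= sqnormc (xs (enum_rank p) x)].
have sq_meas t := (Linfty_sqnorm_term a t Lxs).1.
have mle t (c : R) : measurable [set x | c <= sqnormc (term_val a xs t x)].
  by rewrite -[mkset _]setTI; apply: measurable_fun_le => //; exact: sq_meas.
have mC p : measurable (C p) by exact: (mle (pattern_var p)).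
have markov j c : 0 < c ->
    fine (mu [set x | c <= sqnormc (term_val a xs (condition_term j) x)]) <=
    (condition_target q j + e) / c.
  move=> c0; rewrite ler_pdivlMr// mulrC.
  have [mt it] := Linfty_sqnorm_term a (condition_term j) Lxs.
  by apply: le_trans (cond j); apply: markov_Rintegral => // x; exact: sqnormc_ge0.
pose D0 := [set x | ((1 - h) ^+ 2) ^+ #|T| <= sqnormc (term_val a xs cover_term x)].
have D0P x : (forall p, ~ C p x) -> D0 x.
  move=> nC; rewrite /D0/= cover_term_val sqnormc_prod.
  have <- : \prod_(p <- enum T) ((1 - h) ^+ 2) = ((1 - h) ^+ 2) ^+ #|T|.
    by rewrite big_const_seq count_predT -cardT iter_mulr_1.
  apply: ler_prod => p _; rewrite sqr_ge0/=; apply: sqnormc_1sub; first lra.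
  by rewrite ltNge; apply/negP; exact: nC.
(* the exceptional points: [inl g] when nothing is seen at [g x], [inr c] when
   the conflict [c] is seen *)
pose A (i : B + T * B * T) : set X := match i with
  | inl g => a (val g) @^-1` D0
  | inr c => if conflict c then C c.1.1 `&` a (val c.1.2) @^-1` C c.2 else set0
  end.
have mA i : measurable (A i).
  case: i => [g|c] /=; first by apply: measurable_act_preimage; exact: mle.
  by case: ifP => // _; apply: measurableI => //; exact: measurable_act_preimage.
have /andP[c0 c1] := sqr_exprn_itv #|T| h0 h1.
have hh0 : 0 < h ^+ 2 * h ^+ 2 by rewrite mulr_gt0// exprn_gt0.
have hh1 : h ^+ 2 * h ^+ 2 <= 1 by rewrite -exprD exprn_ile1 ?ltW.
have muA i : fine (mu (A i)) <= e / (((1 - h) ^+ 2) ^+ #|T| * (h ^+ 2 * h ^+ 2)).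
  case: i => [g|c] /=.
    rewrite act_preserving//; last exact: mle.
    have := markov (inr None) _ c0; rewrite add0r => /le_trans; apply.
    by rewrite ler_wpM2l// lef_pV2 ?posrE ?mulr_gt0// ler_piMr// ltW.
  have [cc|_] := ifP; last first.
    by rewrite measure0/= divr_ge0// mulr_ge0// ltW.
  have := markov (inr (Some c)) _ hh0; rewrite add0r => mc.
  apply: (@le_trans _ _ (e / (h ^+ 2 * h ^+ 2))).
    have mCC : measurable (C c.1.1 `&` a (val c.1.2) @^-1` C c.2).
      by apply: measurableI => //; exact: measurable_act_preimage.
    have mt := mle (condition_term (inr (Some c))) (h ^+ 2 * h ^+ 2).
    apply: le_trans mc; apply: fine_le; rewrite ?fin_num_measure//.
    apply: le_measure; rewrite ?inE// => x [/= Cx C'x].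
    by rewrite conflict_term_val// sqnormcM ler_pM// exprn_ge0// ltW.
  by rewrite ler_wpM2l// lef_pV2 ?posrE ?mulr_gt0// ler_piMl// ltW.
pose code x : {ffun T -> bool} := [ffun p => `[< C p x >]].
pose label (s : {ffun T -> bool}) : 'I_k :=
  if [pick p | s p] is Some p then p ball_one else Ordinal k0.
pose f x := label (code x).
have mf : labelling f.
  move=> j; rewrite (_ : _ @^-1` _ = [set x | label (code x) == j]).
    exact: (measurable_finite_code (fun s => label s == j) mC).
  by apply/seteqP; split => x /= /eqP.
exists f => // p; rewrite local_statE.
have := @measure_le_sum _ _ _ mu _ (pattern_event E a f p) (C p) A
  (measurable_pattern_event a p mf) (mC p) mA.
move=> /(_ _)/le_trans; apply.
  move=> x px; have [?|nA] := pselect (exists i, A i x); [by right|left].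
  have fC y : (exists p', C p' y) -> exists2 p', C p' y & f y = p' ball_one.
    move=> [p' Cp']; rewrite /f /label; case: pickP => [p''|/(_ p')].
      by rewrite ffunE => /asboolP ?; exists p''.
    by rewrite ffunE => /asboolP.
  have covered (g : B) : exists2 p', C p' (a (val g) x) & f (a (val g) x) = p' ball_one.
    apply: fC; apply: contrapT => /forallNP nC; apply: nA.
    by exists (inl g); apply: D0P.
  have [p1 Cp1 _] := covered ball_one; rewrite /= act1 in Cp1.
  suff -> : p = p1 by [].
  apply/ffunP => g; rewrite -(px g); have [p' Cp' ->] := covered g.
  apply/eqP; rewrite eq_sym; apply: contrapT => /negP cc; apply: nA.
  by exists (inr (p1, g, p')); rewrite /= ifT.
apply: lerD.
  by apply: (markov (inl p)); rewrite exprn_gt0.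
apply: le_trans (ler_sum _ (fun i _ => muA i)) _.
by rewrite sumr_const.
Qed.

End values.
End pattern_sentence.

Section sentences_to_statistics.
Context (R : realType) (G : groupType) (E : {fset G}).
Context d (X : measurableType d) (mu : probability X R) (a b : pmp_action G mu).

(** The sentence has value 0 for [b], by the indicators of the patterns of a
    labelling, so it has arbitrarily small values for [a]. *)
Lemma sigma1_local_statistics : standard_borel R X ->
  (forall phi : sigma1_sentence G R, sigma1_val a phi <= sigma1_val b phi) ->
  forall r k, local_statistics E b r k `<=` local_statistics E a r k.
Proof.
move=> sX ab r k p0 [p0d p0cl]; split => // e e0.
have e20 : 0 < e / 2 by rewrite divr_gt0.
have [g mg p0g] := p0cl (e / 2) e20.
set q := local_stat E b r g in p0g.
have k0 : (0 < k)%N by apply: leq_ltn_trans (ltn_ord (g point)).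
pose T := pattern E r k; pose eps := e / (2 * #|T|.+1%:R).
have eps0 : 0 < eps by rewrite divr_gt0// mulr_gt0.
have [h [kap [h01 kap0 budget]]] := rounding_budget #|T|
  #|{: cayley_ball E r + T * cayley_ball E r * T}| eps0.
have [xs Lxs xsk] : exists2 xs, forall i, Linfty mu (xs i) &
    formula_val a xs (deviation (@condition_term R G E r k) (condition_target q)) <= kap.
  pose phi := deviation_sentence (@condition_term R G E r k) (condition_target q).
  have aphi : sigma1_val a phi < kap.
    apply: le_lt_trans kap0; apply: le_trans (ab phi) _.
    have [ys Lys ysq] := @pattern_conditions_indicator R G E r k _ X mu b g mg.
    apply: ge_inf; first exact: (sigma1_set_has_inf phi b sX).2.
    by exists ys.
  have [_ [xs Lxs <-] xsk] := inf_lt (sigma1_set_has_inf phi a sX).1 aphi.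
  by exists xs => //; exact: ltW.
have [f mf fq] := pattern_conditions_round h01 (ltW kap0) k0 Lxs xsk.
exists f => //.
have qd : distribution_on q by exact: local_stat_distribution.
have fqe p : local_stat E a r f p <= q p + eps.
  apply: (le_trans (fq p)); apply: budget.
  have [q0 q1] := qd.
  by rewrite q0 -q1 (bigD1 p)//= lerDl sumr_ge0.
have qf : tv_dist q (local_stat E a r f) <= e / 2.
  have fd : distribution_on (local_stat E a r f) by exact: local_stat_distribution.
  apply: le_trans (tv_dist_le_onesided fd qd (ltW eps0) fqe) _.
  rewrite -[_ *+ _]mulr_natr /eps invfM mulrA -mulrA ler_piMr//.
    by rewrite divr_ge0// ltW.
  by rewrite mulrC ler_pdivrMr// mul1r ler_nat.
by rewrite (le_lt_trans (tv_distD _ q _))// [e]splitr ltr_leD.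
Qed.

End sentences_to_statistics.

(** * Laws of random bit sequences *)

Section bit_sequences.
Context (I : Type).

Definition cylinders : set (set (I -> bool)) :=
  [set [set w : I -> bool | all w F] | F in [set: seq I]].

Lemma setI_closed_cylinders : setI_closed cylinders.
Proof.
move=> _ _ [F _ <-] [F' _ <-]; exists (F ++ F') => //.
by apply/seteqP; split => w /=; rewrite all_cat => /andP.
Qed.

Definition bits := g_sigma_algebraType cylinders.

Lemma measurable_all F : measurable [set w : bits | all w F].
Proof. by apply: sub_sigma_algebra; exists F. Qed.

Lemma measurable_bit i : measurable [set w : bits | w i].
Proof.
rewrite (_ : mkset _ = [set w : bits | all w [:: i]]); first exact: measurable_all.
by apply/seteqP; split => w /=; rewrite andbT.
Qed.

End bit_sequences.

(** Preimages commute with complements and countable unions. *)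
Lemma preimage_generated d (Z : measurableType d) Y (G : set (set Y)) (h : Z -> Y) :
  (forall B, G B -> measurable (h @^-1` B)) ->
  forall B, <<s G >> B -> measurable (h @^-1` B).
Proof.
move=> mG B; apply: (@smallest_sub _ _ _ [set B | measurable (h @^-1` B)]) => //.
split => /=.
- by rewrite preimage_set0.
- by move=> C mC; rewrite setTD preimage_setC; exact: measurableC.
- by move=> C mC; rewrite preimage_bigcup; exact: bigcup_measurable.
Qed.

Lemma preimage_bits_measurable d (Z : measurableType d) I (F : Z -> bits I) :
  (forall i, measurable [set z | F z i]) ->
  forall S : set (bits I), measurable S -> measurable (F @^-1` S).
Proof.
move=> mF S; apply: preimage_generated => _ [s _ <-].
rewrite (_ : _ @^-1` _ = [set z | all (F z) s])//.
elim: s => [|i s IH] /=; first by rewrite (_ : mkset _ = setT)//; apply/seteqP.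
rewrite (_ : mkset _ = [set z | F z i] `&` [set z | all (F z) s]).
  exact: measurableI.
by apply/seteqP; split => z /= /andP.
Qed.

(** Cylinders form a pi-system, so they determine the law of a random bit sequence. *)
Lemma bits_law_unique (R : realType) I d (X : measurableType d) (mu : probability X R)
    d' (Y : measurableType d') (nu : probability Y R)
    (F : X -> bits I) (c : Y -> bits I) :
  (forall i, measurable [set x | F x i]) -> (forall i, measurable [set y | c y i]) ->
  (forall s, mu [set x | all (F x) s] = nu [set y | all (c y) s]) ->
  forall S : set (bits I), measurable S -> mu (F @^-1` S) = nu (c @^-1` S).
Proof.
move=> mF mc Fc S mS.
have mF' : measurable_fun setT F.
  by move=> _ A mA; rewrite setTI; exact: preimage_bits_measurable.
have mc' : measurable_fun setT c.
  by move=> _ A mA; rewrite setTI; exact: preimage_bits_measurable.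
pose F' : {mfun X >-> bits I} := mfun_Sub (mem_set mF').
pose c' : {mfun Y >-> bits I} := mfun_Sub (mem_set mc').
have unique := @measure_unique _ R (bits I) (@cylinders I) (fun=> setT) erefl
  (@setI_closed_cylinders I) _ _ (pushforward mu F') (pushforward nu c') _ _ S mS.
apply: unique.
- by move=> _; exists [::] => //; apply/seteqP.
- by rewrite bigcup_const//; exists 0%N.
- by move=> _ [s _ <-]; exact: Fc.
- by move=> k /=; rewrite /pushforward preimage_setT probability_setT ltry.
Qed.

(** * Coding standard Borel spaces by bit sequences *)

Section standard_coding.
Context (R : realType) d (X : measurableType d).
Context (Y : completePseudoMetricType R) (phi : X -> Y) (psi : Y -> X).
Hypotheses (hausY : hausdorff_space Y) (phiK : cancel phi psi) (psiK : cancel psi phi).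
Hypothesis measurableX : @measurable d X = preimage_set_system setT phi <<s @open Y >>.
Variable y : nat -> Y.
Hypothesis y_dense : dense (range y).

Let rad (m : nat) : R := m.+1%:R^-1.

Let rad_gt0 m : 0 < rad m. Proof. by rewrite invr_gt0. Qed.

Let rad_le m n : (m <= n)%N -> rad n <= rad m.
Proof. by move=> mn; rewrite lef_pV2 ?posrE// ler_nat. Qed.

(** The interior is taken because balls need not be open. *)
Definition code_set (i : nat * nat) : set X := phi @^-1` (ball (y i.2) (rad i.1))°.

Definition code (x : X) : bits (nat * nat) := fun i => `[< code_set i x >].

Lemma measurable_open_preimage V : open V -> measurable (phi @^-1` V).
Proof.
move=> oV; rewrite measurableX; exists V; last by rewrite setTI.
exact: sub_sigma_algebra.
Qed.

Lemma measurable_code_set i : measurable (code_set i).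
Proof. by apply: measurable_open_preimage; exact: open_interior. Qed.

(** A dense point within half the radius of [phi x] has a ball around it that is a
    neighbourhood of [phi x]. *)
Lemma code_set_cover m x : exists j, code_set (m, j) x.
Proof.
have O0 : (ball (phi x) (rad m / 2))° !=set0.
  by exists (phi x); apply: nbhsx_ballx; rewrite divr_gt0.
have [z [+ [j _ jz]]] := y_dense O0 (open_interior _).
rewrite -jz => /interior_subset/ball_sym xj; exists j.
apply/nbhs_ballP; exists (rad m / 2) => /=; first by rewrite divr_gt0.
by move=> t xt; rewrite [rad m]splitr; exact: ball_triangle xj xt.
Qed.

(** [j] is the first index, at scale [m], of a dense point that a point coded by
    [w] is close to. *)
Let first (w : bits (nat * nat)) m j := w (m, j) /\ forall j', (j' < j)%N -> ~~ w (m, j').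

Let first_exists (w : bits (nat * nat)) m j : w (m, j) -> exists j, first w m j.
Proof.
move=> wj; have ex : exists j, w (m, j) by exists j.
exists (ex_minn ex); case: ex_minnP => i wi imin; split=> // j' j'i.
by apply/negP => /imin; rewrite leqNgt j'i.
Qed.

Let first_uniq w m j j' : first w m j -> first w m j' -> j = j'.
Proof.
move=> [wj jmin] [wj' j'min]; apply/eqP; rewrite eqn_leq (leqNgt j) (leqNgt j').
by apply/andP; split; apply/negP; [move/jmin|move/j'min] => /negP.
Qed.

Let measurable_first m j : measurable [set w : bits (nat * nat) | first w m j].
Proof.
rewrite (_ : mkset _ = [set w : bits (nat * nat) | w (m, j)] `&`
    \bigcap_(j' < j) ~` [set w : bits (nat * nat) | w (m, j')]).
  apply: measurableI; first exact: measurable_bit.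
  by apply: bigcap_measurableType => j' _; apply: measurableC; exact: measurable_bit.
apply/seteqP; split => w /= [wj jmin]; split => // j' j'j; first exact/negP/jmin.
exact/negP/jmin.
Qed.

(** The codes for which the selected dense points form a fast Cauchy sequence. *)
Let good : set (bits (nat * nat)) := [set w | (forall m, exists j, first w m j) /\
  forall m n j j', (m <= n)%N -> first w m j -> first w n j' ->
    ball (y j) (2 * rad m) (y j')].

Let measurable_good : measurable good.
Proof.
rewrite (_ : good = (\bigcap_m \bigcup_j [set w : bits (nat * nat) | first w m j]) `&`
  \bigcap_m \bigcap_n \bigcap_j \bigcap_j' (if `[< (m <= n)%N ->
    ball (y j) (2 * rad m) (y j') >] then setT else
      ~` ([set w : bits (nat * nat) | first w m j] `&` [set w : bits (nat * nat) | first w n j']))).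
  apply: measurableI.
    by apply: bigcap_measurableType => m _; apply: bigcup_measurable.
  do 4 (apply: bigcap_measurableType => ? _).
  by case: asboolP => // _; apply: measurableC; exact: measurableI.
apply/seteqP; split => w /=.
  move=> [wex wb]; split=> [m _|m _ n _ j _ j' _].
    by have [j wj] := wex m; exists j.
  case: asboolP => // /not_implyP[mn nb] [wj wj']; apply: nb.
  exact: wb wj wj'.
move=> [wex wb]; split=> [m|m n j j' mn wj wj'].
  by have [j _ wj] := wex m I; exists j.
have := wb m I n I j I j' I; case: asboolP => [+ _|_ []//]; exact.
Qed.

Let point_seq (w : bits (nat * nat)) (m : nat) : Y := y (xget 0%N [set j | first w m j]).

Let point_seqE w m j : first w m j -> point_seq w m = y j.
Proof.
move=> wj; rewrite /point_seq; case: xgetP => [i _ wi|/(_ j)//].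
by rewrite (first_uniq wi wj).
Qed.

Let point_seq_ball w m n : good w -> (m <= n)%N ->
  ball (point_seq w m) (2 * rad m) (point_seq w n).
Proof.
move=> [wex wb] mn; have [j wj] := wex m; have [j' wj'] := wex n.
by rewrite (point_seqE wj) (point_seqE wj'); exact: wb wj wj'.
Qed.

Let rad_small (e : R) : 0 < e -> exists m, rad m < e.
Proof.
by move=> e0; have [m _ /(_ m (leqnn _))] := near_infty_natSinv_lt (PosNum e0); exists m.
Qed.

Let point_seq_cvg w : good w -> cvg (point_seq w @ \oo).
Proof.
move=> gw; apply: cauchy_cvg; apply: cauchy_exP => e e0.
have [m me] := rad_small (divr_gt0 e0 (ltr0Sn R 1)).
exists (point_seq w m); exists m => // n /= mn.
apply: le_ball (point_seq_ball gw mn).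
by rewrite mulrC -ler_pdivlMr// ltW.
Qed.

Let point_seq_lim_ball w m : good w ->
  ball (point_seq w m) (3 * rad m) (lim (point_seq w @ \oo)).
Proof.
move=> gw; have /(_ _ (nbhsx_ballx _ _ (rad_gt0 m))) := point_seq_cvg gw.
move=> [n _ /(_ (maxn m n) (leq_maxr _ _))/ball_sym nl].
rewrite (_ : 3 * rad m = 2 * rad m + rad m); last by ring.
exact: ball_triangle (point_seq_ball gw (leq_maxl _ _)) nl.
Qed.

(** Defined on all bit sequences: those that are read off the points of an
    ultrapower are codes of points of [X] only almost everywhere. *)
Definition decode (w : bits (nat * nat)) : X :=
  if `[< good w >] then psi (lim (point_seq w @ \oo)) else point.

(** The points selected by the code of [x] converge to [phi x], and limits are
    unique in [Y]. *)
Lemma codeK : cancel code decode.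
Proof.
move=> x.
have firstx m j : first (code x) m j -> ball (y j) (rad m) (phi x).
  by move=> [/asboolP/interior_subset].
have gx : good (code x).
  split=> [m|m n j j' mn /firstx jx /firstx j'x].
    by have [j xj] := code_set_cover m x; apply: (@first_exists _ _ j); exact/asboolP.
  apply: le_ball (ball_triangle jx (ball_sym j'x)).
  by rewrite mulr_natl mulr2n lerD2l rad_le.
rewrite /decode ifT; last exact/asboolP.
rewrite -[RHS]phiK; congr psi; apply: (cvg_lim hausY).
apply/cvg_ballP => e e0; have [m me] := rad_small e0.
exists m => // n /= mn.
have [j /[dup] xj /firstx jx] := gx.1 n; rewrite (point_seqE xj).
by apply: le_ball (ball_sym jx); apply: le_trans (ltW me); exact: rad_le.
Qed.

(** For [V] open, the limit is in [V] if and only if at some scale the ball around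
    the selected point that is known to contain the limit lies in [V]. This condition
    only involves countably many bits, once [first] selects the point. *)
Lemma measurable_decode A : measurable A -> measurable (decode @^-1` A).
Proof.
rewrite [X in X A]measurableX => -[V sV <-]; rewrite setTI -comp_preimage.
apply: preimage_generated V sV => V oV.
rewrite (_ : _ @^-1` V = good `&` (\bigcup_m \bigcup_j
    (if `[< ball (y j) (3 * rad m) `<=` V >]
     then [set w : bits (nat * nat) | first w m j] else set0)) `|`
  (if `[< V (phi point) >] then ~` good else set0)).
  apply: measurableU; last by case: asboolP => // _; exact: measurableC.
  apply: measurableI => //; do 2 (apply: bigcup_measurable => ? _).
  by case: asboolP.
apply/seteqP; split => w /=; rewrite /decode.
  case: asboolP => [gw|bw]; last by right; rewrite ifT//; exact/asboolP.
  rewrite /= psiK => Vl; left; split=> //.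
  have /nbhs_ballP[e /= e0 eV] : nbhs (lim (point_seq w @ \oo)) V by exact: open_nbhs_nbhs.
  have [m me] := rad_small (divr_gt0 e0 (ltr0Sn R 5)).
  have [j wj] := gw.1 m; exists m => //; exists j => //; rewrite ifT//; apply/asboolP.
  move=> z jz; apply: eV.
  have := point_seq_lim_ball m gw; rewrite (point_seqE wj) => /ball_sym jl.
  apply: le_ball (ball_triangle jl jz).
  by rewrite -mulrDl -natrD mulrC -ler_pdivlMr// ltW.
case=> [[gw [m _ [j _]]]|].
  case: asboolP => // jV wj; rewrite ifT; last exact/asboolP.
  by rewrite /= psiK; apply: jV; rewrite -(point_seqE wj); exact: point_seq_lim_ball.
by case: asboolP => // Vp bw; rewrite ifF//; exact/negbTE/asboolPn.
Qed.

End standard_coding.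

Lemma standard_borel_coding (R : realType) d (X : measurableType d) : standard_borel R X ->
  exists (B : nat * nat -> set X) (theta : bits (nat * nat) -> X),
    [/\ forall i, measurable (B i),
        cancel (fun x i => `[< B i x >]) theta &
        forall A, measurable A -> measurable (theta @^-1` A)].
Proof.
move=> [Y [phi [hausY [D cD dD] [psi phiK psiK] mX]]].
have /countable_injP[h hinj] := cD.
pose y n := xget (phi point) [set z | D z /\ h z = n].
have dy : dense (range y).
  move=> V V0 oV; have [z [Vz Dz]] := dD V V0 oV; exists z; split=> //.
  exists (h z) => //; rewrite /y; case: xgetP => [z' _ [Dz' hz']|/(_ z)[]//].
  by apply: hinj; rewrite ?inE.
exists (code_set phi y), (decode psi y); split.
- exact: measurable_code_set.
- exact: codeK.
- exact: measurable_decode.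
Qed.

(** * From statistics to weak containment *)

(** Any ultrafilter finer than the cofinite filter is nonprincipal. *)
Lemma np_ultrafilter_exists : exists U : np_ultrafilter, \oo `<=` large U.
Proof.
have [L [ultraL ooL]] := ultraFilterLemma eventually_filter.
have npL n : ~ L [set n].
  move=> Ln; apply: (@filter_not_empty _ L).
  have /ooL : \oo [set m | (n < m)%N] by exists n.+1.
  by apply: filterS2 Ln => m /= -> ; rewrite ltnn.
by exists (NPUltrafilter ultraL npL).
Qed.

Section ultrapowers.
Context (U : np_ultrafilter) (G : groupType) (R : realType).
Context d (X : measurableType d) (mu : probability X R) (a : pmp_action G mu).

Lemma ultra_act_internal g (A : nat -> set X) :
  ultra_action U a g @^-1` internal U A = internal U (fun N => a g @^-1` A N).
Proof.
by apply/seteqP; split; elim/quotW => x; rewrite /preimage/= ultra_act_pi =>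
  /internalP ?; apply/internalP.
Qed.

Lemma measurable_internal (A : nat -> set X) : (forall N, measurable (A N)) ->
  measurable (internal U A : set (caratheodory_type (ultra_content U mu)^*%mu)).
Proof.
move=> mA; apply: sub_caratheodory; apply: sub_sigma_algebra.
by exists A.
Qed.

Lemma internal_all I (A : I -> nat -> set X) (s : seq I) :
  [set x | all (fun i => `[< internal U (A i) x >]) s] =
  internal U (fun N => [set x | all (fun i => `[< A i N x >]) s]).
Proof.
have all_cons T (C : I -> set T) i t : [set x | all (fun i => `[< C i x >]) (i :: t)] =
    C i `&` [set x | all (fun i => `[< C i x >]) t].
  apply/seteqP; split => x /=; first by move=> /andP[/asboolP].
  by move=> [Cx xt]; rewrite xt andbT; exact/asboolP.
elim: s => [|i s IH].
  apply/seteqP; split=> //; elim/quotW => x _; apply/internalP.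
  exact: filterS filterT.
rewrite all_cons IH internalI; congr internal; apply/funext => N.
by rewrite (all_cons _ (fun i => A i N)).
Qed.

End ultrapowers.

Section statistics_to_weak_containment.
Context (R : realType) (G : groupType) (E : {fset G}) (markE : marking E).
Context d (X : measurableType d) (mu : probability X R) (a b : pmp_action G mu).
Context (I : countType) (B : I -> set X) (mB : forall i, measurable (B i)).
Hypothesis ba : forall r k, local_statistics E b r k `<=` local_statistics E a r k.

(** A label is a sequence of [N] bits; the bit of rank [n] is the one of the index
    [i : I] with code [n]. *)
Let label N := 'I_#|{: {ffun 'I_N -> bool}}|.

Let bit N (l : label N) (i : I) : bool :=
  if insub (choice.pickle i) is Some n then (enum_val l : {ffun 'I_N -> bool}) n else false.

Let truncation N (y : X) : label N :=
  enum_rank [ffun n : 'I_N => if choice.unpickle n is Some i then `[< B i y >] else false].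

Let bit_truncation N y i : (choice.pickle i < N)%N -> bit (truncation N y) i = `[< B i y >].
Proof. by move=> iN; rewrite /bit insubT enum_rankK ffunE /= choice.pickleK. Qed.

Let labelling_truncation N : labelling (truncation N).
Proof.
move=> l; rewrite (_ : _ @^-1` _ = \bigcap_(n in [set: 'I_N])
    (if choice.unpickle n is Some i
     then (if (enum_val l : {ffun 'I_N -> bool}) n then B i else ~` B i)
     else if (enum_val l : {ffun 'I_N -> bool}) n then set0 else setT)).
  apply: fin_bigcap_measurable; first exact: finite_finset.
  move=> n _; case: (choice.unpickle n) => [i|]; case: ifP => // _; exact: measurableC.
apply/seteqP; split => y /=.
  move=> <- n _; rewrite enum_rankK ffunE.
  by case: (choice.unpickle n) => [i|//]; case: asboolP.
move=> yl; rewrite -[RHS]enum_valK; congr enum_rank; apply/ffunP => n; rewrite ffunE.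
have := yl n Logic.I; case: (choice.unpickle n) => [i|]; case: (_ n) => //= ?.
  exact/asboolP.
exact/asboolPn.
Qed.

(** Labellings for [a] imitating longer and longer truncations of the bit
    sequences of [b] combine into internal sets of the ultrapower. *)
Lemma internal_copy : exists (U : np_ultrafilter) (A : I -> nat -> set X),
  (forall i N, measurable (A i N)) /\
  forall s : seq (G * I),
    ultra_measure U mu
      [set x | all (fun t => `[< internal U (A t.2) (ultra_action U a t.1 x) >]) s] =
    mu [set y | all (fun t => `[< B t.2 (b t.1 y) >]) s].
Proof.
have [U ooU] := np_ultrafilter_exists.
have ex N : exists f : X -> label N, labelling f /\
    tv_dist (local_stat E b N (truncation N)) (local_stat E a N f) < N.+1%:R^-1.
  have [//|f ? ?] := @local_statistics_approx _ _ _ _ _ _ a b ba N _ _ N.+1%:R^-1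
    (@labelling_truncation N).
  by exists f.
pose f N : X -> label N := projT1 (cid (ex N)).
have fP N : labelling (f N) /\
    tv_dist (local_stat E b N (truncation N)) (local_stat E a N (f N)) < N.+1%:R^-1.
  exact: projT2 (cid (ex N)).
pose A i N := [set x | bit (f N x) i].
have mA i N : measurable (A i N).
  by apply: (@fun_of_finite_measurable _ _ _ (f N) (fun l => bit l i)) => l; exact: (fP N).1.
exists U, A; split => // s.
pose S N (w : G -> label N) := all (fun t => bit (w t.1) t.2) s.
have SF N : supported_on [seq t.1 | t <- s] (S N).
  move=> w w' ww'; apply: eq_in_all => t ts; congr bit; apply: ww'.
  exact: map_f.
have mS N : measurable [set x | S N (itinerary a (f N) x)].
  exact: (measurable_cylinder a markE (SF N) (fP N).1).
have -> : [set x | all (fun t => `[< internal U (A t.2) (ultra_action U a t.1 x) >]) s] =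
    internal U (fun N => [set x | S N (itinerary a (f N) x)]).
  have := internal_all U (fun (t : G * I) N => a t.1 @^-1` A t.2 N) s.
  under [X in X = _ -> _]eq_set do under eq_all do
    rewrite -ultra_act_internal.
  move=> ->; congr internal; apply/funext => N; apply/seteqP; split => x /=;
    by under eq_all do rewrite asboolb.
have [r Fr] := cayley_ball_cover markE [seq t.1 | t <- s].
pose M := \max_(t <- s) (choice.pickle t.2).+1.
have cS : \forall N \near \oo, [set y | all (fun t => `[< B t.2 (b t.1 y) >]) s] =
    [set y | S N (itinerary b (truncation N) y)].
  exists M => // N /= MN.
  have eqS y : all (fun t => `[< B t.2 (b t.1 y) >]) s = S N (itinerary b (truncation N) y).
    apply: eq_in_all => t ts; rewrite bit_truncation//.
    by apply: leq_trans MN; rewrite (leq_bigmax_seq _ ts).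
  by apply/seteqP; split => y /=; rewrite eqS.
have lim_a : (fun N => fine (mu [set x | S N (itinerary a (f N) x)])) @ \oo -->
    fine (mu [set y | all (fun t => `[< B t.2 (b t.1 y) >]) s]).
  apply/cvgrPdist_lt => e e0; near=> N.
  have -> : [set y | all (fun t => `[< B t.2 (b t.1 y) >]) s] =
      [set y | S N (itinerary b (truncation N) y)] by near: N; exact: cS.
  apply: (@le_lt_trans _ _ N.+1%:R^-1); last by near: N; exact: near_infty_natSinv_lt (PosNum e0).
  apply: le_trans (ltW (fP N).2).
  apply: (cylinder_close a b (SF N) _ (fP N).1 (@labelling_truncation N)) => g /Fr.
  by apply: cayley_ball_mono; near: N; exact: nbhs_infty_ge.
have lim_U : (fun N => fine (mu [set x | S N (itinerary a (f N) x)])) @ large U -->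
    fine (mu [set y | all (fun t => `[< B t.2 (b t.1 y) >]) s]).
  by move=> V /lim_a/ooU.
have eq_fine := @cvg_unique R (@Rhausdorff R) _ _ _ _ (ultra_measure_internal mS) lim_U.
have mc : measurable [set y | all (fun t => `[< B t.2 (b t.1 y) >]) s].
  elim: (s) => [|t s' IH] /=; first by rewrite (_ : mkset _ = setT)//; apply/seteqP.
  rewrite (_ : mkset _ = (b t.1 @^-1` B t.2) `&`
      [set y | all (fun t => `[< B t.2 (b t.1 y) >]) s']).
    by apply: measurableI => //; exact: measurable_act_preimage.
  apply/seteqP; split => y /=; first by move=> /andP[/asboolP].
  by move=> [By ys]; rewrite ys andbT; exact/asboolP.
rewrite -[LHS]fineK ?fin_num_measure//; last exact: measurable_internal.
by rewrite eq_fine fineK ?fin_num_measure.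
Unshelve. all: by end_near.
Qed.

End statistics_to_weak_containment.

Section factor_map.
Context (R : realType) (G : groupType) (E : {fset G}) (markE : marking E).
Context d (X : measurableType d) (mu : probability X R) (a b : pmp_action G mu).

(** [theta] applied to the internal copy of the code. Equivariance at [g] says that
    the code bits at [g x], decoded, agree with the translate of the decoding of the
    code bits at [x]. This is a measurable condition on the joint code of all
    translates of [x]; it holds everywhere for [b], hence almost everywhere in the
    ultrapower, where the joint code has the same law. *)
Lemma local_statistics_weakly_contains : standard_borel R X ->
  (forall r k, local_statistics E b r k `<=` local_statistics E a r k) ->
  weakly_contains a b.
Proof.
move=> /standard_borel_coding[B [theta [mB thetaK mtheta]]] ba.
have [U [A [mA law]]] := internal_copy markE mB ba.
pose ua := ultra_action U a; set la := ultra_measure U mu in law ua *.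
pose XU := caratheodory_type (ultra_content U mu)^*%mu.
pose F (x : XU) : bits (G * (nat * nat)) := fun t => `[< internal U (A t.2) (ua t.1 x) >].
pose c (y : X) : bits (G * (nat * nat)) := fun t => `[< B t.2 (b t.1 y) >].
have mF t : measurable [set x | F x t].
  rewrite (_ : mkset _ = ua t.1 @^-1` internal U (A t.2)).
    by apply: measurable_act_preimage; exact: measurable_internal.
  by apply/seteqP; split => x /asboolP.
have mc t : measurable [set y | c y t].
  rewrite (_ : mkset _ = b t.1 @^-1` B t.2); first exact: measurable_act_preimage.
  by apply/seteqP; split => y /asboolP.
have Flaw := bits_law_unique mF mc law.
pose slice (w : bits (G * (nat * nat))) g : bits (nat * nat) := fun i => w (g, i).
have mslice g S : measurable S -> measurable (slice^~ g @^-1` S).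
  by apply: preimage_bits_measurable => i; exact: measurable_bit.
have slicec y g : theta (slice (c y) g) = b g y by rewrite -[RHS]thetaK.
pose f x := theta (slice (F x) 1%g).
have fE g x : f (ua g x) = theta (slice (F x) g).
  rewrite /f; congr theta; apply/funext => i.
  by congr (asbool (internal U (A i) _)); exact: (act1 ua).

have fpre S : f @^-1` S = F @^-1` (slice^~ 1%g @^-1` (theta @^-1` S)) by [].
exists U, f; split.
- move=> _ S mS; rewrite setTI fpre.
  exact: (preimage_bits_measurable mF (mslice _ _ (mtheta _ mS))).
- move=> S mS; rewrite fpre Flaw; last exact: (mslice _ _ (mtheta _ mS)).
  congr (mu _); apply/seteqP; split => y; rewrite /preimage/= slicec act1//.
- move=> g.
  pose W := [set w | theta (slice w g) <> b g (theta (slice w 1%g))].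
  have mW : measurable W.
    (* two points differ exactly when some bit of their codes does *)
    pose P i := (slice^~ g @^-1` (theta @^-1` B i)).
    pose Q i := (slice^~ 1%g @^-1` (theta @^-1` (b g @^-1` B i))).
    have mP i : measurable (P i) by exact: (mslice _ _ (mtheta _ (mB i))).
    have mQ i : measurable (Q i).
      by apply: (mslice _ _ (mtheta _ _)); exact: measurable_act_preimage.
    rewrite (_ : W = \bigcup_i (P i `\` Q i `|` Q i `\` P i)).
      apply: countable_bigcupT_measurable => [|i]; first exact: countableP.
      by apply: measurableU; exact: measurableD.
    apply/seteqP; split => w; last first.
      by move=> [i _ [[Pi Qi]|[Qi Pi]]] /= ww; [apply: Qi|apply: Pi];
        rewrite /P /Q /preimage/= ?ww// -ww.
    move=> /= ww; apply: contrapT => nPQ; apply: ww.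
    rewrite -[LHS]thetaK -[RHS]thetaK; congr theta; apply/funext => i.
    apply/asbool_equiv_eq; split => wi; apply: contrapT => nwi; apply: nPQ; exists i => //.
      by left.
    by right.
  exists (F @^-1` W); split.
  + exact: (preimage_bits_measurable mF mW).
  + rewrite Flaw// (_ : c @^-1` W = set0) ?measure0//.
    by apply/seteqP; split => // y; rewrite /preimage/W/= !slicec act1.
  + by move=> x; rewrite /W/= -fE.
Qed.

End factor_map.

(** * From weak containment to statistics *)

Section internal_approximation.
Context (U : np_ultrafilter) (R : realType) d (X : measurableType d) (mu : probability X R).
Let XU := caratheodory_type (ultra_content U mu)^*%mu.
Let la : probability XU R := ultra_measure U mu.

(** A measurable set is approximated by a cover by internal sets of nearly
    equal mass, hence by a finite part of the cover. *)
Lemma internal_approx (S : set XU) (e : R) : measurable S -> 0 < e ->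
  exists A : nat -> set X, (forall N, measurable (A N)) /\
    fine (la (S `\` internal U A `|` internal U A `\` S)) <= e.
Proof.
move=> mS e0.
have e20 : 0 < e / 2 by rewrite divr_gt0.
have Sfin : la S \is a fin_num by exact: fin_num_measure.
have [_ [F [mF SF] <-] Fe] := lb_ereal_inf_adherent e20 Sfin.
have mF' k : measurable (F k : set XU).
  by have [A mA <-] := mF k; exact: measurable_internal.
pose W := \bigcup_k F k.
have mW : measurable (W : set XU) by exact: bigcup_measurable.
have SW : S `<=` W by [].
have WS : fine (la (W `\` S)) <= e / 2.
  have laW : (la W < la S + (e / 2)%:E)%E.
    apply: le_lt_trans Fe; apply: ereal_inf_lbound; exists F => //; split => //.
  rewrite measureD//; last by rewrite -ge0_fin_numE// fin_num_measure.
  rewrite setIidr// fineB ?fin_num_measure// lerBlDl -lee_fin EFinD !fineK ?fin_num_measure//.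
  exact: ltW.
pose V n := \big[setU/set0]_(k < n) F k.
have mV n : measurable (V n : set XU) by exact: bigsetU_measurable.
have [n Wn] : exists n, fine (la (W `\` V n)) <= e / 2.
  have cvg0 : (fun n => la (W `\` V n)) @ \oo --> la set0.
    rewrite (_ : set0 = \bigcap_n (W `\` V n)).
      apply: nonincreasing_cvg_mu => //.
      - by rewrite -ge0_fin_numE// fin_num_measure//; exact: measurableD.
      - by move=> n; exact: measurableD.
      - by apply: bigcap_measurableType => n _; exact: measurableD.
      - move=> m n mn; apply/subsetPset; apply: setDS; rewrite /V -!bigcup_mkord.
        by move=> x [k /= km Fk]; exists k => //=; exact: leq_trans mn.
    apply/esym; rewrite -subset0 => x Wx; have [[k _ Fk] _] := Wx 0%N I.
    have [_] := Wx k.+1 I; apply; rewrite /V -bigcup_mkord.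
    by exists k => /=.
  have /cvgrPdist_lt/(_ _ e20) : (fun n => fine (la (W `\` V n))) @ \oo --> (0 : R).
    by apply: fine_cvg; rewrite measure0 in cvg0.
  move=> [n _ /(_ n (leqnn n))]; rewrite sub0r normrN => Vn; exists n.
  by apply: ltW; apply: le_lt_trans Vn; exact: ler_norm.
have /cid2[A mA AV] : internal_measurable (V n).
  exact: (@bigsetU_measurable _ (ultrapower U X)).
exists A; split=> //; rewrite AV.
have mSV : measurable (S `\` V n `|` V n `\` S : set XU).
  by apply: measurableU; exact: measurableD.
have := @measure_le_sum _ _ _ la 'I_1 _ (W `\` S) (fun=> W `\` V n) mSV
  (measurableD mW mS) (fun=> measurableD mW (mV n)).
rewrite big_ord1 => /(_ _)/le_trans; apply; last by rewrite [e]splitr lerD.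
move=> x [[Sx nVx]|[Vx nSx]]; [right|left].
  by exists ord0; split => //; exact: SW.
by split=> //; move: Vx; rewrite /V -bigcup_mkord => -[k _ Fk]; exists k.
Qed.

End internal_approximation.

Section weak_containment_to_statistics.
Context (R : realType) (G : groupType) (E : {fset G}).
Context d (X : measurableType d) (mu : probability X R) (a b : pmp_action G mu).

Section lifting.
Context (U : np_ultrafilter) (f : caratheodory_type (ultra_content U mu)^*%mu -> X).
Let XU := caratheodory_type (ultra_content U mu)^*%mu.
Let la : probability XU R := ultra_measure U mu.
Let ua : pmp_action G la := ultra_action U a.
Hypothesis mf : measurable_fun [set: XU] f.
Hypothesis f_preserving : forall S, measurable S -> la (f @^-1` S) = mu S.
Hypothesis f_equivariant : forall g, {ae la, forall x, f (ua g x) = b g (f x)}.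

Let measurable_f S : measurable S -> measurable (f @^-1` S).
Proof. by move=> mS; rewrite -[_ @^-1` _]setTI; exact: mf. Qed.

(** Each label set, pulled back along the factor map, is close to an internal set.
    Away from the errors these internal sets partition the space, so that the label
    can be read off from them. *)
Lemma internal_labelling k (g : X -> 'I_k) (e : R) : labelling g -> 0 < e ->
  exists (h : nat -> X -> 'I_k) (bad : set XU),
    [/\ forall N, labelling (h N), measurable bad, fine (la bad) <= e &
      forall j x, internal U (fun N => h N @^-1` [set j]) x -> ~ bad x -> g (f x) = j].
Proof.
move=> mg e0; pose eta := e / k.+1%:R; have eta0 : 0 < eta by rewrite divr_gt0.
pose S j : set XU := f @^-1` (g @^-1` [set j]).
have mS j : measurable (S j) by exact: measurable_f.
have /choice[A AP] j := internal_approx (mS j) eta0.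
have mA j N : measurable (A j N) by exact: (AP j).1.
pose D j : set XU := S j `\` internal U (A j) `|` internal U (A j) `\` S j.
have mD j : measurable (D j).
  by apply: measurableU; apply: measurableD => //; exact: measurable_internal.
pose label (s : {ffun 'I_k -> bool}) := if [pick j | s j] is Some j then j else g point.
pose h N x := label [ffun j => `[< A j N x >]].
exists h, (\bigcup_(j in [set: 'I_k]) D j); split.
- move=> N j; rewrite (_ : _ @^-1` _ = [set x | label [ffun j => `[< A j N x >]] == j]).
    exact: (measurable_finite_code (fun s => label s == j) (fun j => mA j N)).
  by apply/seteqP; split => x /= /eqP.
- by apply: fin_bigcup_measurable => // ; exact: finite_finset.
- have mbad : measurable (\bigcup_(j in [set: 'I_k]) D j).
    by apply: fin_bigcup_measurable => // ; exact: finite_finset.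
  have := @measure_le_sum _ _ _ la 'I_k _ set0 D mbad measurable0 mD.
  rewrite measure0 add0r => /(_ _)/le_trans; apply.
    by move=> x [j _ Dx]; right; exists j.
  apply: (@le_trans _ _ (\sum_(j < k) eta)).
    by apply: ler_sum => j _; exact: (AP j).2.
  rewrite sumr_const card_ord -[_ *+ k]mulr_natr /eta -mulrA ger_pMr//.
  by rewrite mulrC ler_pdivrMr// mul1r ler_nat.
- move=> j; elim/quotW => x /internalP hx nbad.
  set z := \pi_(ultrapower U X) x in nbad *.
  pose j' := g (f z).
  have SA i : S i z <-> internal U (A i) z.
    split => [Sz|Az]; apply: contrapT => n; apply: nbad; exists i => //; first by left.
    by right.
  have Aj' : large U [set N | A j' N (x N)] by apply/internalP/SA.
  have nA i : large U [set N | i != j' -> ~ A i N (x N)].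
    have [->|ij'] := eqVneq i j'; first by apply: filterS filterT.
    have : (~` internal U (A i)) z by move/SA => /= ij; rewrite -ij eqxx in ij'.
    by rewrite internalC => /internalP; apply: filterS => N ? _.
  have : large U [set N | forall i, i != j' -> ~ A i N (x N)] by exact: filter_forall.
  move=> nA'; apply: contrapT => jj'; apply: (@filter_not_empty _ (large U)).
  apply: filterS3 hx Aj' nA' => N /= hN AN nAN; apply: jj'; rewrite -hN.
  rewrite /h /label; case: pickP => [i|/(_ j')]; last by rewrite ffunE => /asboolP.
  rewrite ffunE => /asboolP Ai; apply/eqP; apply: contrapT => /negP; rewrite eq_sym => ij'.
  exact: nAN ij' Ai.
Qed.

Lemma pattern_event_internal r k (h : nat -> X -> 'I_k) (p : pattern E r k) :
  [set x | forall g : cayley_ball E r, internal U (fun N => h N @^-1` [set p g]) (ua (val g) x)] =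
  internal U (fun N => pattern_event E a (h N) p).
Proof.
apply/seteqP; split; elim/quotW => x /=.
  move=> px; apply/internalP.
  have : large U [set N | forall g : cayley_ball E r, h N (a (val g) (x N)) = p g].
    apply: filter_forall => g; have := px g.
    by rewrite ultra_act_pi => /internalP.
  exact.
move=> /internalP px g; rewrite ultra_act_pi; apply/internalP.
by apply: filterS px => N /(_ g).
Qed.

(** A point of the internal pattern event [p] none of whose translates in the ball
    is bad, or breaks equivariance, is mapped by [f] to a point with pattern [p]. *)
Lemma local_stat_lift r k (g : X -> 'I_k) (c : R) : labelling g -> 0 < c ->
  exists2 h : X -> 'I_k, labelling h &
    forall p, local_stat E a r h p <= local_stat E b r g p + c.
Proof.
move=> mg c0.
pose B := cayley_ball E r; pose m := #|{: B + B}|.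
have cm0 : 0 < c / 2 / m.+1%:R by rewrite !divr_gt0.
have [h [bad [mh mbad badc hbad]]] := internal_labelling mg cm0.
have limit (p : pattern E r k) :
    fine (la (internal U (fun N => pattern_event E a (h N) p))) <=
    local_stat E b r g p + c / 2.
  have /choice[Z ZP] (i : B) := f_equivariant (val i).
  pose C (i : B + B) : set XU :=
    match i with inl j => ua (val j) @^-1` bad | inr j => Z j end.
  have mC i : measurable (C i).
    by case: i => j; [exact: (measurable_act_preimage ua (val j) mbad)|case: (ZP j)].
  have mP : measurable (pattern_event E b g p) by exact: measurable_pattern_event.
  have mQ : measurable (internal U (fun N => pattern_event E a (h N) p) : set XU).
    by apply: measurable_internal => N; exact: measurable_pattern_event.
  have := @measure_le_sum _ _ _ la (B + B)%type _ (f @^-1` pattern_event E b g p) C mQ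
    (measurable_f mP) mC.
  rewrite f_preserving// -local_statE => /(_ _)/le_trans; apply.
    move=> x; rewrite -pattern_event_internal /= => px.
    have [?|nC] := pselect (exists i, C i x); [by right|left=> i].
    have <- : f (ua (val i) x) = b (val i) (f x).
      by apply: contrapT => ne; apply: nC; exists (inr i); have [_ _] := ZP i; apply.
    by apply: hbad (px i) _ => bx; apply: nC; exists (inl i).
  rewrite lerD2l; apply: (@le_trans _ _ (\sum_(i : B + B) c / 2 / m.+1%:R)).
    apply: ler_sum => -[j|j] _.
      by have -> : la (C (inl j)) = la bad by exact: (act_preserving ua).
    have [_ Z0 _] := ZP j.
    by have -> : la (C (inr j)) = 0%E by []; exact: ltW.
  rewrite sumr_const -/m -[_ *+ m]mulr_natr -mulrA ger_pMr ?divr_gt0//.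
  by rewrite mulrC ler_pdivrMr// mul1r ler_nat.
(* the measure of an internal set is the limit of the measures of its components *)
have near_U (p : pattern E r k) :
    large U [set N | local_stat E a r (h N) p <= local_stat E b r g p + c].
  have mp N : measurable (pattern_event E a (h N) p) by exact: measurable_pattern_event.
  have /cvgrPdist_lt/(_ (c / 2)) := ultra_measure_internal (mu := mu) (U := U) mp.
  move=> /(_ (divr_gt0 c0 (ltr0Sn R 1))); apply: filterS => N /=.
  rewrite local_statE distrC => /(le_lt_trans (ler_norm _)) => hN; apply: ltW.
  have := limit p; rewrite -[la _]/(ultra_measure U mu _) => lp.
  by move: hN lp; set u := fine _; set v := fine _; lra.
have all_U : large U [set N | forall p : pattern E r k,
    local_stat E a r (h N) p <= local_stat E b r g p + c] by exact: filter_forall.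
have [N NP] := filter_ex all_U.
by exists (h N).
Qed.

End lifting.

(** The upper bounds of [local_stat_lift] give closeness in total variation by
    [tv_dist_le_onesided]. *)
Lemma weakly_contains_local_statistics : weakly_contains a b ->
  forall r k, local_statistics E b r k `<=` local_statistics E a r k.
Proof.
move=> [U [f [mf fp fe]]] r k p0 [p0d p0cl]; split=> // e e0.
have e20 : 0 < e / 2 by rewrite divr_gt0.
have [g mg p0g] := p0cl _ e20.
pose c := e / 2 / #|pattern E r k|.+1%:R; have c0 : 0 < c by rewrite divr_gt0.
have [h mh hg] : exists2 h : X -> 'I_k, labelling h & forall p,
    local_stat E a r h p <= local_stat E b r g p + c.
  exact: (local_stat_lift mf fp fe).
exists h => //.
apply: (le_lt_trans (tv_distD _ (local_stat E b r g) _)); rewrite [e]splitr ltr_leD//.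
have hd : distribution_on (local_stat E a r h) by exact: local_stat_distribution.
have gd : distribution_on (local_stat E b r g) by exact: local_stat_distribution.
apply: le_trans (tv_dist_le_onesided hd gd (ltW c0) hg) _.
rewrite -[_ *+ _]mulr_natr /c -mulrA ger_pMr//.
by rewrite mulrC ler_pdivrMr// mul1r ler_nat.
Qed.

End weak_containment_to_statistics.

(** * The equivalence *)

Theorem theorem1p1 (R : realType) (G : groupType) (E : {fset G})
    (markE : marking E)
    (d : measure_display) (X : measurableType d) (mu : probability X R)
    (stdX : standard_borel R X)
    (a b : pmp_action G mu) (freea : free_action a) (freeb : free_action b) :
  (weakly_contains a b <->
     forall r k : nat, local_statistics E b r k `<=` local_statistics E a r k) /\
  (weakly_contains a b <->
     forall phi : sigma1_sentence G R, sigma1_val a phi <= sigma1_val b phi).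
Proof.
have wc_stat := @weakly_contains_local_statistics R G E d X mu a b.
have stat_wc := local_statistics_weakly_contains markE stdX.
split; split => //; first exact: stat_wc.
  by move=> /wc_stat; exact: local_statistics_sigma1.
by move=> ab; apply: stat_wc; exact: sigma1_local_statistics.
Qed.
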